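(* Let $(g_n)$ be the metrics of a Brill-Lindquist-Riemann sum for $(A,B)$ and let $g=(\chi\psi)^2 g_{\mathbb E}$. Fix $R>\sqrt{3}D$. The set $$\mathcal U_{n,R}:=B(0,R)\smallsetminus\Big(\bigcup_i B\big(p_{i,n},\tfrac{D}{n^2}\big)\Big)$$ equipped with the metric $g_n$ converges in the Gromov-Hausdorff sense as $n\to\infty$ to the set $B(0,R)$ equipped with the metric $g$.
   Context: $g_{\mathbb E}$ is the Euclidean metric on $\mathbb R^3$ and $B(p,r)$ denotes the open Euclidean ball. Fix $D>0$ and smooth non-negative functions $A,B$ supported in $[-D,D]^3$. For each $n\in\mathbb N$ subdivide $[-D,D]^3$ into $(2n)^3$ boxes $V_{i,n}$ of side $D/n$, with centers $p_{i,n}$ (the points $(\tfrac{a+1/2}{n}D,\tfrac{b+1/2}{n}D,\tfrac{c+1/2}{n}D)$ with integers $-n\le a,b,c<n$). A Brill-Lindquist-Riemann sum for $(A,B)$ is given by a family of parameters $\alpha_{i,n},\beta_{i,n}\ge 0$ with $$\sup_{i,n} n^4|\alpha_{i,n}-A(p_{i,n})(D/n)^3|<\infty,\qquad \sup_{i,n} n^4|\beta_{i,n}-B(p_{i,n})(D/n)^3|<\infty,$$ and the associated metrics $g_n=(\chi_n\psi_n)^2g_{\mathbb E}$, where $\chi_n(x)=1+\sum_i\frac{\alpha_{i,n}}{|x-p_{i,n}|}$, $\psi_n(x)=1+\sum_i\frac{\beta_{i,n}}{|x-p_{i,n}|}$. Boxes with $\alpha_{i,n}=\beta_{i,n}=0$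 are disregarded, i.e. the index $i$ (also in the union defining $\mathcal U_{n,R}$) ranges over those boxes with $\alpha_{i,n}+\beta_{i,n}\neq0$. The limit functions are $\chi(x)=1+\int\frac{A(y)}{|x-y|}\,dy$ and $\psi(x)=1+\int\frac{B(y)}{|x-y|}\,dy$. A set equipped with a Riemannian metric is regarded as a metric space with the distance given by the infimum of lengths of piecewise smooth paths inside the set. The Gromov-Hausdorff distance of two metric spaces is the infimum of Hausdorff distances of their images under distance-preserving maps into a common metric space. *)

(* Defs.v *)
From HB Require Import structures.
From mathcomp Require Import all_boot all_order all_algebra.
From mathcomp Require Import all_classical all_reals all_analysis.
Set Implicit Arguments.
Unset Strict Implicit.
Unset Printing Implicit Defensive.
Import Order.TTheory GRing.Theory Num.Theory.
Import numFieldNormedType.Exports.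
Local Open Scope classical_set_scope.
Local Open Scope ring_scope.

(* The norm that the library puts on [R * R * R] is the max norm; it is used
   only for topology and differentiability, which do not depend on the choice
   of norm. The Euclidean structure is given by [edot] and [enorm]. *)
Definition E3 (R : realType) : normedModType R := (R * R * R)%type.

Definition edot (R : realType) (v w : E3 R) : R :=
  v.1.1 * w.1.1 + v.1.2 * w.1.2 + v.2 * w.2.

Definition enorm (R : realType) (v : E3 R) : R := Num.sqrt (edot v v).

Definition eball (R : realType) (p : E3 R) (r : R) : set (E3 R) :=
  [set x | enorm (x - p) < r].

Definition lebesgue3 (R : realType) :
    {measure set (measurableTypeR R * measurableTypeR R * measurableTypeR R)
       -> \bar R} :=
  ((@lebesgue_measure R \x @lebesgue_measure R) \x @lebesgue_measure R)%E.

(* All iterated directional derivatives exist and are Frechet differentiable: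
   in finite dimension this is C^oo. *)
Definition smooth (R : realType) (V W : normedModType R) (f : V -> W) : Prop :=
  forall (vs : seq V) (x : V),
    differentiable (foldr (fun v h => 'D_v h) f vs) x.

Definition supported_in (R : realType) (C : set (E3 R)) (f : E3 R -> R) : Prop :=
  closure [set x | f x != 0] `<=` C.

Definition cube (R : realType) (D : R) : set (E3 R) :=
  [set x | [/\ `|x.1.1| <= D, `|x.1.2| <= D & `|x.2| <= D]].

(* A Riemannian metric as a field of bilinear forms on R^3. *)
Definition metric_field (R : realType) := E3 R -> E3 R -> E3 R -> R.

Definition conformal (R : realType) (f : E3 R -> R) : metric_field R :=
  fun x v w => f x ^+ 2 * edot v w.

(* The pieces are smooth up to their end points: each one is the restriction
   of a smooth curve. As consecutive pieces share an end point, such a path is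
   continuous on [a, b]. *)
Definition piecewise_smooth (R : realType) (a b : R) (gamma : R -> E3 R) : Prop :=
  exists2 s : seq R, itv_partition a b s &
    forall k : nat, (k < size s)%N ->
      exists2 c : R^o -> E3 R, smooth c &
        {in `[nth b (a :: s) k, nth b (a :: s) k.+1], gamma =1 c}.

(* [gamma] is differentiable at all but finitely many points of [a, b]; the
   value of [derive1 gamma] at the others does not affect the integral. *)
Definition path_length (R : realType) (g : metric_field R) (a b : R)
    (gamma : R -> E3 R) : \bar R :=
  (\int[lebesgue_measure]_(t in `[a, b])
     (Num.sqrt (g (gamma t) (derive1 gamma t) (derive1 gamma t)))%:E)%E.

(* The infimum is +oo when no path inside [U] joins [x] to [y]. *)
Definition path_dist (R : realType) (U : set (E3 R)) (g : metric_field R)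
    (x y : E3 R) : \bar R :=
  ereal_inf [set l | exists (a b : R) (gamma : R -> E3 R),
    [/\ a < b /\ piecewise_smooth a b gamma,
        {in `[a, b], forall t, U (gamma t)},
        gamma a = x /\ gamma b = y
      & l = path_length g a b gamma]].

Definition hausdorff_dist (R : realType) (Z : metricType R) (S T : set Z) : \bar R :=
  ereal_inf [set e%:E | e in [set e : R |
    [/\ 0 < e,
        forall x, S x -> exists2 y, T y & mdist x y < e
      & forall y, T y -> exists2 x, S x & mdist x y < e]]].

(* [isometric_on X d f]: [f] is distance-preserving on [(X, d)]; its values
   outside [X] are irrelevant. *)
Definition isometric_on (R : realType) (T : Type) (X : set T)
    (d : T -> T -> \bar R) (Z : metricType R) (f : T -> Z) : Prop :=
  forall x y, X x -> X y -> (mdist (f x) (f y))%:E = d x y.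

(* If [dX] takes the value +oo on [X] (so that [(X, dX)] is not a metric space
   in the strict sense) there is no distance-preserving map, and the infimum
   is +oo. *)
Definition GH_dist (R : realType) (T T' : Type) (X : set T)
    (dX : T -> T -> \bar R) (Y : set T') (dY : T' -> T' -> \bar R) : \bar R :=
  ereal_inf [set h | exists (Z : metricType R) (f : T -> Z) (f' : T' -> Z),
    [/\ isometric_on X dX f, isometric_on Y dY f'
      & h = hausdorff_dist (f @` X) (f' @` Y)]].

(* The [(2n)^3] boxes; the integer [a] with [-n <= a < n] is encoded by
   [a + n < 2n]. There is no box for [n = 0]. *)
Definition box (n : nat) : finType := ('I_n.*2 * 'I_n.*2 * 'I_n.*2)%type.

Definition center_coord (R : realType) (D : R) (n : nat) (j : 'I_n.*2) : R :=
  (j%:R - n%:R + 2^-1) / n%:R * D.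

Definition box_center (R : realType) (D : R) (n : nat) (i : box n) : E3 R :=
  (center_coord D i.1.1, center_coord D i.1.2, center_coord D i.2).

(* The supremum runs over all boxes, including those with vanishing parameters. *)
Definition riemann_parameters (R : realType) (D : R) (A : E3 R -> R)
    (alpha : forall n, box n -> R) : Prop :=
  (forall n (i : box n), 0 <= alpha n i) /\
  (ereal_sup [set s | exists (n : nat) (i : box n),
     s = (n%:R ^+ 4 * `|alpha n i - A (box_center D i) * (D / n%:R) ^+ 3|)%:E]
     < +oo)%E.

(* A box with [m i = 0] contributes 0 everywhere, also at its centre since
   [0^-1 = 0]; so the sum may run over all boxes. *)
Definition sum_factor (R : realType) (D : R) (n : nat) (m : box n -> R)
    (x : E3 R) : R :=
  1 + \sum_(i : box n) m i / enorm (x - box_center D i).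

Definition limit_factor (R : realType) (A : E3 R -> R) (x : E3 R) : R :=
  1 + \int[@lebesgue3 R]_y (A y / enorm (x - y)).

Definition perforated_ball (R : realType) (D : R) (alpha beta : forall n, box n -> R)
    (n : nat) (rho : R) : set (E3 R) :=
  eball 0 rho `\`
  \bigcup_(i in [set i : box n | alpha n i + beta n i != 0])
    eball (box_center D i) (D / n%:R ^+ 2).

(* Main.v *)
Require Import Defs.
From HB Require Import structures.
From mathcomp Require Import all_boot all_order all_algebra.
From mathcomp Require Import all_classical all_reals all_analysis.
From mathcomp Require Import measurable_realfun ring lra.
Set Implicit Arguments.
Unset Strict Implicit.
Unset Printing Implicit Defensive.
Import Order.TTheory GRing.Theory Num.Theory.
Import numFieldNormedType.Exports.
Local Open Scope classical_set_scope.
Local Open Scope ring_scope.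

(* Away from the removed balls the discrete potentials converge uniformly to the
   Newtonian potentials: the kernel [|x - y|^-2] is integrable near its pole, so
   comparing box by box a point mass at [p_i] with the smeared-out mass costs [O(1/n)],
   and the single box whose center is close to [x] contributes [O(1/n)] because
   [|x - p_i| >= D/n^2] while [alpha_i = O(n^-3)]. Hence a path avoiding the balls has
   almost the same length for [g_n] and for [g]. Conversely a path in the ball is cut
   into pieces of Euclidean length [D/(16n)]; each piece is replaced by its chord, and
   a chord that meets a removed ball (at most one is within reach) is translated
   sideways by the radius [D/n^2]. With [O(n)] pieces this adds only [O(1/n)] to the
   length, so the inclusion of the perforated ball distorts distances by [o(1)]. *)

(** * Euclidean structure *)

(** Small distortion becomes small Gromov-Hausdorff distance through an explicit metric on the
    disjoint union of the two spaces, in which changing sides has a fixed cost. All kernel estimates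
    go through one dyadic majorant of |x - y|^-2. It is infinite at the pole, and its integral is
    bounded uniformly in x because the dimension is three. The obstacle in rerouting is that the
    points where a path is cut may themselves lie in holes, so each is first moved outside by at
    most twice the radius of a hole. Chords are kept so short, compared with the spacing of the
    centers, that a chord and its translate stay near a single center and the density is almost
    constant there. Pieces are cut by Euclidean length but counted by length for the limit metric,
    which is larger because the density is at least 1. This bounds the number of pieces without any
    arc length parametrization. *)

Section Euclid.
Variable R : realType.
Implicit Types (x y z v w p : E3 R) (a b : R).

Lemma edotC v w : edot v w = edot w v.
Proof. by rewrite /edot; ring. Qed.

Lemma edotDl v w z : edot (v + w) z = edot v z + edot w z.
Proof. by rewrite /edot/=; ring. Qed.

Lemma edotZl a v w : edot (a *: v) w = a * edot v w.
Proof. by rewrite /edot /= /GRing.scale/=; ring. Qed.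

Lemma edotNl v w : edot (- v) w = - edot v w.
Proof. by rewrite -scaleN1r edotZl mulN1r. Qed.

Lemma edotDr v w z : edot z (v + w) = edot z v + edot z w.
Proof. by rewrite edotC edotDl !(edotC z). Qed.

Lemma edotZr a v w : edot w (a *: v) = a * edot w v.
Proof. by rewrite edotC edotZl (edotC w). Qed.

Lemma edotNr v w : edot w (- v) = - edot w v.
Proof. by rewrite edotC edotNl (edotC w). Qed.

Lemma edot_ge0 v : 0 <= edot v v.
Proof. by rewrite /edot -!expr2 !addr_ge0// sqr_ge0. Qed.

Lemma enorm_ge0 v : 0 <= enorm v.
Proof. exact: sqrtr_ge0. Qed.

Lemma enorm2 v : enorm v ^+ 2 = edot v v.
Proof. by rewrite /enorm sqr_sqrtr// edot_ge0. Qed.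

Lemma enorm0 : enorm (0 : E3 R) = 0.
Proof. by rewrite /enorm /edot/= !mulr0 !addr0 sqrtr0. Qed.

Lemma enormZ a v : enorm (a *: v) = `|a| * enorm v.
Proof.
by rewrite /enorm edotZl edotZr mulrA -expr2 sqrtrM ?sqr_ge0// sqrtr_sqr.
Qed.

Lemma enormN v : enorm (- v) = enorm v.
Proof. by rewrite /enorm edotNl edotNr opprK. Qed.

Lemma enorm_distC v w : enorm (v - w) = enorm (w - v).
Proof. by rewrite -enormN opprB. Qed.

Lemma edot_le_enorm v w : edot v w <= enorm v * enorm w.
Proof.
have [|h] := leP (edot v w) 0; first by move/le_trans; apply; rewrite mulr_ge0// enorm_ge0.
rewrite -(@ler_pXn2r _ 2)// ?nnegrE ?mulr_ge0 ?enorm_ge0 ?(ltW h)//.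
rewrite exprMn !enorm2.
rewrite -subr_ge0 /edot.
set a := v.1.1; set b := v.1.2; set c := v.2.
set d := w.1.1; set e := w.1.2; set f := w.2.
(* Lagrange's identity: the defect in Cauchy-Schwarz is the squared length of the cross product. *)
rewrite [leRHS](_ : _ = (a * e - b * d) ^+ 2 + (a * f - c * d) ^+ 2 + (b * f - c * e) ^+ 2); last by ring.
by rewrite !addr_ge0// sqr_ge0.
Qed.

Lemma enormD v w : enorm (v + w) <= enorm v + enorm w.
Proof.
rewrite -(@ler_pXn2r _ 2)// ?nnegrE ?addr_ge0 ?enorm_ge0//.
rewrite sqrrD !enorm2 edotDl !edotDr (edotC w v).
have := edot_le_enorm v w; lra.
Qed.

Lemma enorm_triangle x y z : enorm (x - z) <= enorm (x - y) + enorm (y - z).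
Proof. by rewrite (le_trans _ (enormD _ _))// addrA subrK. Qed.

Lemma enorm_eq0 v : enorm v = 0 -> v = 0.
Proof.
move/eqP; rewrite /enorm sqrtr_eq0 => h.
have : edot v v = 0 by apply/eqP; rewrite eq_le h edot_ge0.
rewrite /edot -!expr2 => /eqP; rewrite !paddr_eq0 ?addr_ge0 ?sqr_ge0//.
rewrite !sqrf_eq0 => /andP[/andP[/eqP h1 /eqP h2] /eqP h3].
by case: v h1 h2 h3 {h} => -[? ?] ?/= -> -> ->.
Qed.

Lemma enorm_ge_coord v : [/\ `|v.1.1| <= enorm v, `|v.1.2| <= enorm v & `|v.2| <= enorm v].
Proof.
rewrite /enorm /edot -!(sqrtr_sqr v.1.1) -!(sqrtr_sqr v.1.2) -!(sqrtr_sqr v.2) -!expr2.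
have := sqr_ge0 v.1.1; have := sqr_ge0 v.1.2; have := sqr_ge0 v.2 => *.
by split; rewrite ler_sqrt; lra.
Qed.

Lemma enorm_le_coord v a : `|v.1.1| <= a -> `|v.1.2| <= a -> `|v.2| <= a ->
  enorm v <= Num.sqrt 3 * a.
Proof.
move=> h1 h2 h3; have a0 : 0 <= a := le_trans (normr_ge0 _) h1.
rewrite -(ger0_norm a0) -sqrtr_sqr -sqrtrM// /enorm ler_sqrt ?mulr_ge0 ?sqr_ge0//.
have e u : `|u| <= a -> u * u <= a ^+ 2.
  by move=> h; rewrite -expr2 -real_normK ?num_real// ler_pXn2r// nnegrE.
by have := e _ h1; have := e _ h2; have := e _ h3; rewrite /edot; lra.
Qed.

(** Supplies the direction in which a chord that meets a hole is translated. A nonzero orthogonal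
    vector can be written down explicitly and is then normalised. *)
Lemma unit_perp v : exists2 e : E3 R, enorm e = 1 & edot e v = 0.
Proof.
suff [e e0 ev] : exists2 e : E3 R, e <> 0 & edot e v = 0.
  have ne0 : enorm e != 0 by apply/eqP => /enorm_eq0.
  exists ((enorm e)^-1 *: e); last by rewrite edotZl ev mulr0.
  by rewrite enormZ ger0_norm ?invr_ge0 ?enorm_ge0// mulVf.
have [h|h] := eqVneq v.1.1 0.
  exists (1, 0, 0); first by case=> /eqP; rewrite oner_eq0.
  by rewrite /edot/= h; ring.
exists (- v.1.2, v.1.1, 0); last by rewrite /edot/=; ring.
by case=> _ /eqP; rewrite (negbTE h).
Qed.

End Euclid.

(** * Smooth curves: affine reparametrization and straight lines *)

Section Smooth.
Variable R : realType.

Lemma derive_affine_comp (f : R^o -> E3 R) (k m v t : R) :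
  'D_v (fun t : R^o => f (k * t + m)) t = 'D_(k * v) f (k * t + m).
Proof.
rewrite /derive; set F := fun h : R => _; set G := fun h : R => _.
suff -> : F = G by [].
apply/funext => h; rewrite /F /G /=.
by congr (_ *: (f _ - _)); rewrite /GRing.scale/=; ring.
Qed.

(** The factor [k] is absorbed by the directions: an iterated derivative of the composite is the
    iterated derivative of [c] along the directions multiplied by [k]. *)
Lemma smooth_affine_comp (c : R^o -> E3 R) (k m : R) : smooth c ->
  smooth (fun t : R^o => c (k * t + m)).
Proof.
move=> cS vs x.
have -> : foldr (fun v h => 'D_v h) (fun t : R^o => c (k * t + m)) vs =
    fun t : R^o => foldr (fun v h => 'D_v h) c [seq k * v | v <- vs] (k * t + m).
  elim: vs => [//|v vs ih]; apply/funext => t.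
  transitivity ('D_v (fun t : R^o =>
      foldr (fun v h => 'D_v h) c [seq k * v | v <- vs] (k * t + m)) t).
    by rewrite -ih.
  exact: derive_affine_comp.
apply: (@differentiable_comp _ _ _ _ (fun t : R^o => k * t + m : R^o)
  (foldr (fun v h => 'D_v h) c [seq k * v | v <- vs])); last exact: cS.
apply: differentiableD => //.
Qed.

Lemma derive_line (p q : E3 R) (w t : R^o) :
  'D_w (fun t : R^o => p + t *: q) t = w *: q.
Proof.
rewrite /derive; apply: cvg_lim; first exact: norm_hausdorff.
apply: cvg_near_cst; near=> h; have h0 : h != 0 by near: h; exact: nbhs_dnbhs_neq.
rewrite /= opprD addrACA subrr add0r -scalerBl addrK scalerA /GRing.scale/=.
by rewrite mulrA mulVf// mul1r.
Unshelve. all: by end_near. Qed.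

Lemma smooth_line (x v : E3 R) : smooth (fun t : R^o => x + t *: v).
Proof.
have L (q : E3 R) (t : R^o) : differentiable (fun t : R^o => t *: q) t.
  exact: (@differentiableZl _ _ _ (idfun : R^o -> R) q t).
(* Affine curves are closed under directional derivation, so the induction on the list of directions
   never leaves this class. *)
have H (vs : seq R^o) : exists p q : E3 R,
    foldr (fun v h => 'D_v h) (fun t : R^o => x + t *: v) vs =
      fun t : R^o => p + t *: q.
  elim: vs => [|w vs [p [q E]]]; first by exists x, v.
  exists (w *: q), 0; apply/funext => t; rewrite scaler0 addr0.
  transitivity ('D_w (fun t : R^o => p + t *: q) t); first by rewrite -E.
  by rewrite derive_line.
by move=> vs t; have [p [q ->]] := H vs; exact: differentiableD.
Qed.

Lemma smooth_derivable (c : R^o -> E3 R) t : smooth c -> derivable c t 1.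
Proof. by move=> cS; apply: diff_derivable; exact: (cS [::] t). Qed.

Lemma smooth_continuous (c : R^o -> E3 R) : smooth c -> continuous c.
Proof. by move=> cS t; apply: differentiable_continuous; exact: (cS [::] t). Qed.

Lemma smooth_derive1_continuous (c : R^o -> E3 R) : smooth c ->
  continuous (derive1 c).
Proof.
move=> cS; have -> : derive1 c = 'D_1 c by apply/funext => s; rewrite derive1E.
by move=> t; apply: differentiable_continuous; exact: (cS [:: 1 : R^o] t).
Qed.

End Smooth.

(** * Piecewise smooth paths *)

Section Piecewise.
Variable R : realType.
Implicit Types (a b p q x : R) (gamma : R -> E3 R).

Lemma piecewise_smooth1 gamma a b (c : R^o -> E3 R) : a < b -> smooth c ->
  {in `[a, b], gamma =1 c} -> piecewise_smooth a b gamma.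
Proof.
move=> ab cS gc; exists [:: b]; first exact: itv_partition1.
by move=> [|//] _; exists c.
Qed.

Lemma piecewise_smooth_cons gamma a x b (c : R^o -> E3 R) : a < x -> smooth c ->
  {in `[a, x], gamma =1 c} -> piecewise_smooth x b gamma ->
  piecewise_smooth a b gamma.
Proof.
move=> ax cS gc [s [xs sb] sP]; exists (x :: s).
  by split => //=; rewrite ax.
move=> [|k]; first by move=> _; exists c.
by rewrite /= ltnS => /sP.
Qed.

(** Induction that hides the partition: a property of intervals holds on the whole path if it holds
    on smooth pieces and survives concatenation. *)
Lemma piecewise_smooth_ind gamma (P : R -> R -> Prop) :
  (forall p q (c : R^o -> E3 R), p < q -> smooth c -> {in `[p, q], gamma =1 c} -> P p q) ->
  (forall p x q, p < x -> x < q -> piecewise_smooth p x gamma ->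
     piecewise_smooth x q gamma -> P p x -> P x q -> P p q) ->
  forall a b, a < b -> piecewise_smooth a b gamma -> P a b.
Proof.
move=> P1 P2 a b ab [s]; elim: s a ab => [|x s ih] a ab.
  by move/itv_partition_nil => e; rewrite e ltxx in ab.
move=> axs sP; have [c cS /= gc] := sP 0%N isT.
have ax : a < x by have [/= /andP[]] := axs.
have xs := itv_partition_cons axs.
case: s => [|y s] in ih sP axs xs *.
  have xb := itv_partition_nil xs; subst x; exact: (P1 _ _ c).
have xb : x < b by exact: itv_partition_size_neq0 xs.
have sP' k : (k < size (y :: s))%N -> exists2 c : R^o -> E3 R, smooth c &
    {in `[nth b (x :: y :: s) k, nth b (x :: y :: s) k.+1], gamma =1 c}.
  by move=> ks; exact: (sP k.+1).
apply: (P2 _ x) => //.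
- exact: piecewise_smooth1 gc.
- by exists (y :: s).
- exact: P1 gc.
- exact: ih.
Qed.

Lemma piecewise_smooth_cat gamma a x b : a < x -> piecewise_smooth a x gamma ->
  piecewise_smooth x b gamma -> piecewise_smooth a b gamma.
Proof.
move=> ax pax.
(* The pieces of the first path are prepended to the second one at a time, so the induction property
   is an implication about what follows. *)
apply: (piecewise_smooth_ind
  (P := fun p q => piecewise_smooth q b gamma -> piecewise_smooth p b gamma) _ _ ax pax).
  by move=> p q c pq cS gc; exact: piecewise_smooth_cons gc.
by move=> p y q _ _ _ _ h1 h2 /h2.
Qed.

Lemma eq_piecewise_smooth gamma gamma' a b : a < b ->
  {in `[a, b], gamma =1 gamma'} ->
  piecewise_smooth a b gamma -> piecewise_smooth a b gamma'.
Proof.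
move=> ab e pab.
apply: (piecewise_smooth_ind (P := fun p q => {in `[p, q], gamma =1 gamma'} ->
  piecewise_smooth p q gamma') _ _ ab pab) => //.
  move=> p q c pq cS gc e'; apply: (piecewise_smooth1 pq cS) => t tpq.
  by rewrite -e'// gc.
move=> p x q px xq _ _ h1 h2 e'; apply: (piecewise_smooth_cat px).
- apply: h1 => t; rewrite in_itv/= => /andP[t1 t2]; apply: e'.
  by rewrite in_itv/= t1 (le_trans t2)// ltW.
- apply: h2 => t; rewrite in_itv/= => /andP[t1 t2]; apply: e'.
  by rewrite in_itv/= t2 andbT (le_trans _ t1)// ltW.
Qed.

Lemma piecewise_smooth_shift gamma a b m : a < b ->
  piecewise_smooth a b gamma ->
  piecewise_smooth (a - m) (b - m) (fun t => gamma (t + m)).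
Proof.
move=> ab pab.
apply: (piecewise_smooth_ind (P := fun p q =>
  piecewise_smooth (p - m) (q - m) (fun t => gamma (t + m))) _ _ ab pab).
  move=> p q c pq cS gc; have cS' := smooth_affine_comp 1 m cS.
  apply: (piecewise_smooth1 _ cS'); first by rewrite ltrD2r.
  move=> t; rewrite in_itv/= lerBlDr lerBrDr => tpq.
  by rewrite mul1r gc// in_itv.
move=> p x q px xq _ _ h1 h2; apply: piecewise_smooth_cat h1 h2.
by rewrite ltrD2r.
Qed.

Lemma piecewise_smooth_rev gamma a b : a < b ->
  piecewise_smooth a b gamma ->
  piecewise_smooth (- b) (- a) (fun t => gamma (- t)).
Proof.
move=> ab pab.
apply: (piecewise_smooth_ind (P := fun p q =>
  piecewise_smooth (- q) (- p) (fun t => gamma (- t))) _ _ ab pab).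
  move=> p q c pq cS gc; have cS' := smooth_affine_comp (-1) 0 cS.
  apply: (piecewise_smooth1 _ cS'); first by rewrite ltrN2.
  move=> t; rewrite in_itv/= => /andP[h1 h2].
  by rewrite addr0 mulN1r gc// in_itv/= lerNr h2 lerNl.
move=> p x q px xq _ _ h1 h2; apply: piecewise_smooth_cat h2 h1.
by rewrite ltrN2.
Qed.

Lemma itv_ccU a x b : a <= x -> x <= b -> `[a, b]%classic = `[a, x] `|` `[x, b].
Proof.
move=> ax xb; apply/seteqP; split => t /=; rewrite !in_itv/=.
  by move=> /andP[-> ->]; have [h|/ltW h] := leP t x; [left|right]; rewrite ?h.
move=> [/andP[-> h]|/andP[h ->]]; first by rewrite (le_trans h).
by rewrite (le_trans ax).
Qed.

Lemma piecewise_smooth_continuous gamma a b : a < b ->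
  piecewise_smooth a b gamma -> {within `[a, b], continuous gamma}.
Proof.
move=> ab pab.
apply: (piecewise_smooth_ind (P := fun p q => {within `[p, q], continuous gamma}) _ _ ab pab).
  move=> p q c pq cS gc.
  apply: (@subspace_eq_continuous _ _ _ c) => [t|].
    by rewrite inE /= => /gc.
  by apply: continuous_subspaceT; exact: smooth_continuous.
move=> p x q px xq _ _ h1 h2; rewrite (@itv_ccU p x q) ?ltW//.
by apply: withinU_continuous => //; exact: itv_closed.
Qed.

(** Restricted to the open interval, since at an end point of the piece [gamma] may continue along
    another curve and its derivative need not exist. *)
Lemma derive1_piece gamma (c : R^o -> E3 R) p q : {in `[p, q], gamma =1 c} ->
  {in `]p, q[, derive1 gamma =1 derive1 c}.
Proof.
move=> gc t tpq; rewrite !derive1E; apply: near_eq_derive.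
have := near_in_itvoo tpq; apply: filterS => s spq.
by apply: gc; exact: subset_itv_oo_cc.
Qed.

Lemma enorm_continuous : continuous (@enorm R).
Proof.
move=> x; apply: (@continuous_comp _ _ _ (fun v => edot v v) Num.sqrt); last exact: sqrt_continuous.
have c1 : {for x, continuous (fun v : E3 R => v.1.1)}.
  by apply: (@continuous_comp _ _ _ fst fst); exact: cvg_fst.
have c2 : {for x, continuous (fun v : E3 R => v.1.2)}.
  by apply: (@continuous_comp _ _ _ fst snd); [exact: cvg_fst|exact: cvg_snd].
have c3 : {for x, continuous (fun v : E3 R => v.2)} by exact: cvg_snd.
by apply: cvgD; [apply: cvgD|]; exact: cvgM.
Qed.

Lemma edot_continuous (v : E3 R) : continuous (edot v).
Proof.
move=> x.
have c1 : {for x, continuous (fun v : E3 R => v.1.1)}.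
  by apply: (@continuous_comp _ _ _ fst fst); exact: cvg_fst.
have c2 : {for x, continuous (fun v : E3 R => v.1.2)}.
  by apply: (@continuous_comp _ _ _ fst snd); [exact: cvg_fst|exact: cvg_snd].
have c3 : {for x, continuous (fun v : E3 R => v.2)} by exact: cvg_snd.
by apply: cvgD; [apply: cvgD|]; apply: cvgMr.
Qed.

End Piecewise.

(** * Euclidean length of a path and its comparison with the chord *)

Section Length.
Variable R : realType.
Implicit Types (a b p q x : R) (gamma : R -> E3 R).
Notation mu := (@lebesgue_measure R).

Lemma ge0_integral_itv_cat (h : R -> R) a x b : a <= x -> x <= b ->
  measurable_fun `[a, b] h -> {in `[a, b], forall t, 0 <= h t} ->
  (\int[mu]_(t in `[a, b]) (h t)%:E =
   \int[mu]_(t in `[a, x]) (h t)%:E + \int[mu]_(t in `[x, b]) (h t)%:E)%E.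
Proof.
move=> ax xb mh h0.
have mxb : measurable_fun `]x, b] h.
  apply: measurable_funS mh => //; apply: subset_itv => //=; rewrite bnd_simp//.
rewrite -(@integral_itv_obnd_cbnd _ x); last exact/measurable_EFinP.
have E : `[a, b]%classic = `[a, x] `|` `]x, b].
  apply/seteqP; split => t /=; rewrite !in_itv/=.
    by move=> /andP[-> ->]; have [h'|h'] := leP t x; [left|right].
  move=> [/andP[-> h']|/andP[/ltW h' ->]]; first by rewrite (le_trans h').
  by rewrite (le_trans ax).
rewrite {1}E ge0_integral_setU//.
- by rewrite -E; exact/measurable_EFinP.
- by rewrite -E => t /= tab; rewrite lee_fin h0.
- apply/disj_set2P; apply/seteqP; split => t //=; rewrite !in_itv/=.
  by move=> [/andP[_ t1] /andP[t2 _]]; rewrite leNgt t2 in t1.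
Qed.

Lemma speed_measurable gamma a b : a < b -> piecewise_smooth a b gamma ->
  measurable_fun `[a, b] (fun t => enorm (derive1 gamma t)).
Proof.
move=> ab pab.
apply: (piecewise_smooth_ind (P := fun p q =>
  measurable_fun `[p, q] (fun t => enorm (derive1 gamma t))) _ _ ab pab).
  move=> p q c pq cS gc.
  (* The unspecified values of [derive1 gamma] at the two end points do not affect measurability, so
     the open interval suffices. *)
  apply: (@measurable_realfun.measurable_fun_itv_cc _ p q false true).
  apply: (@eq_measurable_fun _ _ _ _ _ (fun t => enorm (derive1 c t))).
    by move=> t; rewrite inE/= => tpq; rewrite (derive1_piece gc).
  apply: (@measurable_funS _ _ _ _ setT) => //.
  apply: continuous_measurable_fun => t.
  apply: (@continuous_comp _ _ _ (derive1 c) (@enorm R)).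
    exact: smooth_derive1_continuous.
  exact: enorm_continuous.
move=> p x q px xq _ _ h1 h2; rewrite (@itv_ccU _ p x q) ?ltW//.
exact/measurable_funU.
Qed.

Lemma is_derive_edot (v : E3 R) (c : R^o -> E3 R) (u : R^o) :
  derivable c u (1 : R^o) ->
  is_derive u (1 : R^o) (fun u : R^o => edot v (c u) : R^o)
    (edot v (derive1 c u)).
Proof.
move=> dc.
have H : (fun h : R => h^-1 *: (((fun u : R^o => edot v (c u) : R^o) \o shift u)
    (h *: (1 : R^o)) - (edot v (c u) : R^o))) @ 0^' --> (edot v (derive1 c u) : R^o).
  rewrite derive1E.
  have := @cvg_comp _ _ _ _ _ 0^' _ _ dc (@edot_continuous R v ('D_1 c u)).
  apply: cvg_trans; apply: near_eq_cvg; near=> h => /=.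
  by rewrite edotZr edotDr edotNr.
by apply: DeriveDef; [apply/cvg_ex; exists (edot v (derive1 c u) : R^o)|exact: cvg_lim H].
Unshelve. all: by end_near. Qed.

(** On a smooth piece, with v the chord vector, the fundamental theorem of calculus gives |v|^2 as
    the integral of the inner product of v with c', which is at most |v| times the length; then |v|
    is cancelled. Concatenation is the triangle inequality. *)
Lemma enorm_le_speed gamma a b s t : a < b -> piecewise_smooth a b gamma ->
  a <= s -> s <= t -> t <= b ->
  ((enorm (gamma t - gamma s))%:E <=
     \int[mu]_(u in `[s, t]) (enorm (derive1 gamma u))%:E)%E.
Proof.
move=> ab pab.
suff H : forall s t, a <= s -> s < t -> t <= b ->
  ((enorm (gamma t - gamma s))%:E <=
     \int[mu]_(u in `[s, t]) (enorm (derive1 gamma u))%:E)%E.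
  move=> as' + tb; rewrite le_eqVlt => /predU1P[->|]; last by move/H; apply.
  by rewrite subrr enorm0 integral_ge0// => u _; rewrite lee_fin enorm_ge0.
move=> {s t}.
apply: (piecewise_smooth_ind (P := fun a b => forall s t, a <= s -> s < t -> t <= b ->
  ((enorm (gamma t - gamma s))%:E <=
     \int[mu]_(u in `[s, t]) (enorm (derive1 gamma u))%:E)%E) _ _ ab pab).
  move=> p q c pq cS gc s t ps st tq.
  have gc' : {in `[s, t], gamma =1 c}.
    move=> u; rewrite in_itv/= => /andP[u1 u2]; apply: gc.
    by rewrite in_itv/= (le_trans ps u1) (le_trans u2 tq).
  set v := gamma t - gamma s.
  have [->|v0] := eqVneq (enorm v) 0.
    by rewrite integral_ge0// => u _; rewrite lee_fin enorm_ge0.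
  have v_gt0 : 0 < enorm v by rewrite lt_neqAle eq_sym v0 enorm_ge0.
  have dc u : derivable c u 1 by exact: smooth_derivable.
  have mspeed : continuous (fun u => enorm (derive1 c u)).
    move=> u; apply: (@continuous_comp _ _ _ (derive1 c) (@enorm R)).
      exact: smooth_derive1_continuous.
    exact: enorm_continuous.
  have cdot : continuous (fun u => edot v (derive1 c u)).
    move=> u; apply: (@continuous_comp _ _ _ (derive1 c) (edot v)).
      exact: smooth_derive1_continuous.
    exact: edot_continuous.
  have ddot (u : R^o) : is_derive u (1 : R^o) (fun u : R^o => edot v (c u) : R^o)
      (edot v (derive1 c u)).
    exact: is_derive_edot.
  have FTC : (\int[mu]_(u in `[s, t]) (edot v (derive1 c u))%:E =
      (edot v (c t))%:E - (edot v (c s))%:E)%E.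
    apply: (@continuous_FTC2 _ (fun u => edot v (derive1 c u)) (fun u => edot v (c u))) => //.
    - exact: continuous_subspaceT.
    - split.
      + by move=> u _; exact: ex_derive.
      + apply: cvg_at_right_filter; apply: (differentiable_continuous (f := fun u => edot v (c u))).
        apply/derivable1_diffP; exact: ex_derive.
      + apply: cvg_at_left_filter; apply: (differentiable_continuous (f := fun u => edot v (c u))).
        apply/derivable1_diffP; exact: ex_derive.
    - by move=> u _; rewrite derive1E derive_val.
  have vv : ((enorm v ^+ 2)%:E = \int[mu]_(u in `[s, t]) (edot v (derive1 c u))%:E)%E.
    rewrite FTC -EFinB enorm2 -edotNr -edotDr /v !gc'//.
    - by rewrite in_itv/= lexx ltW.
    - by rewrite in_itv/= lexx ltW.
  have -> : (\int[mu]_(u in `[s, t]) (enorm (derive1 gamma u))%:E =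
      \int[mu]_(u in `[s, t]) (enorm (derive1 c u))%:E)%E.
    apply: eq_integral_itv_bounded.
    - apply: (@eq_measurable_fun _ _ _ _ _ (fun t => enorm (derive1 c t))).
        by move=> u; rewrite inE/= => tpq; rewrite (derive1_piece gc').
      by apply: (@measurable_funS _ _ _ _ setT) => //; exact: continuous_measurable_fun.
    - by apply: (@measurable_funS _ _ _ _ setT) => //; exact: continuous_measurable_fun.
    - by move=> u ust; rewrite (derive1_piece gc').
  rewrite -(@lee_pmul2l _ (enorm v)%:E)//.
  rewrite -EFinM -expr2 vv.
  have mE : measurable_fun `[s, t] (fun u => (enorm (derive1 c u))%:E).
    apply/measurable_EFinP.
    by apply: (@measurable_funS _ _ _ _ setT) => //; exact: continuous_measurable_fun.
  rewrite -ge0_integralZl//; last 2 first.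
    by move=> u _; rewrite lee_fin enorm_ge0.
    by rewrite lee_fin ltW.
  have mD : measurable_fun `[s, t] (fun u => (edot v (derive1 c u))%:E).
    apply/measurable_EFinP.
    by apply: (@measurable_funS _ _ _ _ setT) => //; exact: continuous_measurable_fun.
  apply: (le_trans (lee_abs _)); apply: le_trans; first exact: (le_abse_integral mu _ mD).
  apply: ge0_le_integral => //.
  - exact: measurableT_comp.
  - exact: measurable_funeM.
  - move=> u _; rewrite -EFinM lee_fin ler_norml edot_le_enorm andbT.
    by rewrite lerNl -edotNl (le_trans (edot_le_enorm _ _))// enormN.
move=> p x q px xq pw1 pw2 h1 h2 s t ps st tq.
have [tx|xt] := leP t x; first exact: h1.
have [xs|sx] := leP x s; first exact: h2.
rewrite (@ge0_integral_itv_cat _ _ x) ?(ltW sx) ?(ltW xt)//.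
- rewrite addeC; apply: (@le_trans _ _ ((enorm (gamma t - gamma x))%:E +
    (enorm (gamma x - gamma s))%:E)%E).
    by rewrite -EFinD lee_fin enorm_triangle.
  by apply: leeD; [apply: h2|apply: h1].
- apply: measurable_funS (speed_measurable _ (piecewise_smooth_cat px pw1 pw2)) => //.
    by apply: subset_itv; rewrite bnd_simp.
  exact: lt_trans xq.
- by move=> u _; rewrite enorm_ge0.
Qed.

End Length.

(** * Length distances *)

Section Substitution.
Variable R : realType.
Notation mu := (@lebesgue_measure R).

Let shift_fun (m : R) : measurableTypeR R -> measurableTypeR R := fun t => t + m.

Let shift_measurable m : measurable_fun setT (shift_fun m).
Proof. exact: measurable_funD. Qed.

HB.instance Definition _ m := isMeasurableFun.Build _ _ _ _ (shift_fun m)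
  (@shift_measurable m).

Let lebesgue_measure_shift (m : R) (A : set R) : measurable A ->
  pushforward mu (shift_fun m) A = mu A.
Proof.
move=> mA; apply/esym/lebesgue_measure_unique => //= _ [[a b]] _ <-.
rewrite /pushforward (_ : _ @^-1` _ = `]a - m, b - m]%classic); last first.
  by apply/seteqP; split => t; rewrite /= !in_itv/= /shift_fun ltrBlDr lerBrDr.
rewrite !lebesgue_measure_itv/= !lte_fin ltrD2r; case: ifP => // _.
by rewrite -!EFinD; congr EFin; ring.
Qed.

(** Joining two paths translates the parameter interval of the second one, and reversing a path
    reflects it; this change of variables and the next one account for these two operations. *)
Lemma ge0_integral_shift (h : R -> R) (a b m : R) :
  measurable_fun `[a, b] h -> {in `[a, b], forall t, 0 <= h t} ->
  (\int[mu]_(t in `[a, b]) (h t)%:E =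
   \int[mu]_(t in `[(a - m)%R, (b - m)%R]) (h (t + m)%R)%:E)%E.
Proof.
move=> mh h0.
rewrite (_ : `[(a - m), (b - m)]%classic = shift_fun m @^-1` `[a, b]%classic); last first.
  by apply/seteqP; split => t; rewrite /= !in_itv/= /shift_fun lerBlDr lerBrDr.
rewrite -(@ge0_integral_pushforward _ _ _ _ _ (shift_fun m) (shift_measurable m) mu
  `[a, b]%classic (fun t => (h t)%:E))//.
- by apply: eq_measure_integral => //= A mA AS; exact/esym/lebesgue_measure_shift.
- exact/measurable_EFinP.
- by move=> t; rewrite inE/= => /h0; rewrite lee_fin.
Qed.

Lemma ge0_integral_opp (h : R -> R) (a b : R) :
  measurable_fun `[a, b] h -> {in `[a, b], forall t, 0 <= h t} ->
  (\int[mu]_(t in `[a, b]) (h t)%:E =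
   \int[mu]_(t in `[(- b)%R, (- a)%R]) (h (- t)%R)%:E)%E.
Proof.
move=> mh h0.
rewrite (_ : `[(- b), (- a)]%classic = (-%R : _ -> measurableTypeR R) @^-1` `[a, b]%classic); last first.
  by apply/seteqP; split => t; rewrite /= !in_itv/= => /andP[? ?]; lra.
rewrite -(@ge0_integral_pushforward _ _ _ _ _ (-%R : measurableTypeR R -> measurableTypeR R) _ mu
  `[a, b]%classic (fun t => (h t)%:E))//.
- by apply: eq_measure_integral => //= A mA AS; exact/esym/lebesgue_measureN.
- exact/measurable_EFinP.
- by move=> t; rewrite inE/= => /h0; rewrite lee_fin.
Qed.

End Substitution.

Section Length.
Variables (R : realType) (U : set (E3 R)) (f : E3 R -> R).
Hypothesis fc : forall x, U x -> {for x, continuous f}.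
Hypothesis f1 : forall x, U x -> 1 <= f x.
Implicit Types (a b p q : R) (gamma : R -> E3 R).
Notation mu := (@lebesgue_measure R).

Let f0 x : U x -> 0 <= f x.
Proof. by move/f1; exact: le_trans. Qed.

Lemma dens_ge0 gamma t : U (gamma t) -> 0 <= f (gamma t) * enorm (derive1 gamma t).
Proof. by move=> /f0 h; rewrite mulr_ge0// enorm_ge0. Qed.

Lemma path_lengthE gamma a b : {in `[a, b], forall t, U (gamma t)} ->
  path_length (conformal f) a b gamma =
  (\int[mu]_(t in `[a, b]) (f (gamma t) * enorm (derive1 gamma t))%:E)%E.
Proof.
move=> gU; apply: eq_integral => t; rewrite inE/= => /gU/f0 h.
by congr EFin; rewrite /conformal sqrtrM ?sqr_ge0// sqrtr_sqr ger0_norm.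
Qed.

Lemma along_continuous gamma a b : a < b -> piecewise_smooth a b gamma ->
  {in `[a, b], forall t, U (gamma t)} -> {within `[a, b], continuous (f \o gamma)}.
Proof.
move=> ab pab gU; apply/subspace_continuousP => t tab.
have := piecewise_smooth_continuous ab pab.
move=> /subspace_continuousP/(_ t tab) gt.
apply: cvg_comp gt _; apply: fc; exact: gU.
Qed.

Lemma along_measurable gamma a b : a < b -> piecewise_smooth a b gamma ->
  {in `[a, b], forall t, U (gamma t)} -> measurable_fun `[a, b] (f \o gamma).
Proof.
move=> ab pab gU; apply: subspace_continuous_measurable_fun => //.
exact: along_continuous.
Qed.

Lemma dens_measurable gamma a b : a < b -> piecewise_smooth a b gamma ->
  {in `[a, b], forall t, U (gamma t)} ->
  measurable_fun `[a, b] (fun t => f (gamma t) * enorm (derive1 gamma t)).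
Proof.
move=> ab pab gU; apply: measurable_funM; first exact: along_measurable.
exact: speed_measurable.
Qed.

Lemma path_dist_le gamma a b : a < b -> piecewise_smooth a b gamma ->
  {in `[a, b], forall t, U (gamma t)} ->
  (path_dist U (conformal f) (gamma a) (gamma b) <=
   \int[mu]_(t in `[a, b]) (f (gamma t) * enorm (derive1 gamma t))%:E)%E.
Proof.
move=> ab pab gU; rewrite -path_lengthE//; apply: ereal_inf_lbound.
by exists a, b, gamma; split.
Qed.

(** A density at least 1 makes every path at least as long as its Euclidean chord. This gives
    definiteness of the distance and excludes the value -oo. *)
Lemma path_dist_ge (x y : E3 R) : ((enorm (x - y))%:E <= path_dist U (conformal f) x y)%E.
Proof.
apply: le_ereal_inf_tmp => _ [a [b [gamma [[ab pab] gU [<- <-] ->]]]].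
rewrite path_lengthE// enorm_distC.
apply: (le_trans (enorm_le_speed ab pab (lexx a) (ltW ab) (lexx b))).
apply: ge0_le_integral => //.
- by move=> t _; rewrite lee_fin enorm_ge0.
- by apply/measurable_EFinP; exact: speed_measurable.
- by apply/measurable_EFinP; exact: dens_measurable.
- by move=> t tab; rewrite lee_fin ler_peMl ?enorm_ge0//; apply: f1; exact: gU.
Qed.

Lemma path_dist_lt x y (r : \bar R) : (path_dist U (conformal f) x y < r)%E ->
  exists a b gamma, [/\ a < b, piecewise_smooth a b gamma,
    {in `[a, b], forall t, U (gamma t)}, gamma a = x /\ gamma b = y
  & (\int[mu]_(t in `[a, b]) (f (gamma t) * enorm (derive1 gamma t))%:E < r)%E].
Proof.
move=> /ereal_inf_lt[_ [a [b [gamma [[ab pab] gU gxy ->]]]]].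
by rewrite path_lengthE// => lr; exists a, b, gamma.
Qed.

(** The derivatives may differ at the two end points, where the paths are free to leave [[a, b]] in
    different ways; this is a null set. *)
Lemma eq_dens_integral gamma gamma' a b : a < b ->
  piecewise_smooth a b gamma -> {in `[a, b], forall t, U (gamma t)} ->
  {in `[a, b], gamma =1 gamma'} ->
  (\int[mu]_(t in `[a, b]) (f (gamma t) * enorm (derive1 gamma t))%:E =
   \int[mu]_(t in `[a, b]) (f (gamma' t) * enorm (derive1 gamma' t))%:E)%E.
Proof.
move=> ab pab gU e.
have pab' := eq_piecewise_smooth ab e pab.
have gU' : {in `[a, b], forall t, U (gamma' t)} by move=> t tab; rewrite -e//; exact: gU.
have sub : `]a, b[ `<=` `[a, b]%classic by exact: subset_itv_oo_cc.
apply: eq_integral_itv_bounded.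
- by apply: measurable_funS sub _ => //; exact: dens_measurable.
- by apply: measurable_funS sub _ => //; exact: dens_measurable.
- move=> t tab; rewrite (derive1_piece e tab) e//.
  exact: subset_itv_oo_cc.
Qed.

Lemma derive1_shift gamma m t :
  derive1 (fun t => gamma (t + m)) t = derive1 gamma (t + m).
Proof.
rewrite !derive1E; have := @derive_affine_comp R gamma 1 m 1 t.
by rewrite !mul1r; under eq_fun do rewrite mul1r.
Qed.

Lemma path_dist_triangle y x z : (path_dist U (conformal f) x z <=
  path_dist U (conformal f) x y + path_dist U (conformal f) y z)%E.
Proof.
have fin_gt u v : (-oo < path_dist U (conformal f) u v)%E.
  by rewrite (lt_le_trans _ (path_dist_ge u v)) ?ltNyr.
(* Infinite distances are disposed of first, so that paths within [e / 2] of each infimum exist. *)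
have [->|xyoo] := eqVneq (path_dist U (conformal f) x y) +oo%E.
  by rewrite addye ?leey// gt_eqF.
have [->|yzoo] := eqVneq (path_dist U (conformal f) y z) +oo%E.
  by rewrite addey ?leey// gt_eqF.
have xyfin : path_dist U (conformal f) x y \is a fin_num by rewrite fin_real// fin_gt ltey.
have yzfin : path_dist U (conformal f) y z \is a fin_num by rewrite fin_real// fin_gt ltey.
apply/lee_addgt0Pr => e e0.
have e20 : 0 < e / 2 by rewrite divr_gt0.
have [a [b [g1 [ab p1 U1 [g1a g1b] l1]]]] : exists a b gamma, [/\ a < b, piecewise_smooth a b gamma,
    {in `[a, b], forall t, U (gamma t)}, gamma a = x /\ gamma b = y
  & (\int[mu]_(t in `[a, b]) (f (gamma t) * enorm (derive1 gamma t))%:E < path_dist U (conformal f) x y + (e / 2)%:E)%E].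
  by apply: path_dist_lt; rewrite lteDl// lte_fin.
have [c [d [g2 [cd p2 U2 [g2c g2d] l2]]]] : exists a b gamma, [/\ a < b, piecewise_smooth a b gamma,
    {in `[a, b], forall t, U (gamma t)}, gamma a = y /\ gamma b = z
  & (\int[mu]_(t in `[a, b]) (f (gamma t) * enorm (derive1 gamma t))%:E < path_dist U (conformal f) y z + (e / 2)%:E)%E].
  by apply: path_dist_lt; rewrite lteDl// lte_fin.
(* The second path is translated so that its parameter starts at [b], where the first one ends. *)
pose m := c - b; pose d' := d - m.
pose g2' t := g2 (t + m).
have bE : b = c - m by rewrite /m; ring.
have bd' : b < d' by rewrite bE ltrD2r.
have p2' : piecewise_smooth b d' g2' by rewrite bE; exact: piecewise_smooth_shift.
have U2' : {in `[b, d'], forall t, U (g2' t)}.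
  move=> t; rewrite in_itv/= bE /d' => /andP[h1 h2]; apply: U2.
  by rewrite in_itv/= -lerBlDr h1 -lerBrDr.
pose g t := if t <= b then g1 t else g2' t.
have e1 : {in `[a, b], g1 =1 g}.
  by move=> t; rewrite in_itv/= /g => /andP[_ ->].
have e2 : {in `[b, d'], g2' =1 g}.
  move=> t; rewrite in_itv/= /g => /andP[bt _]; case: ifPn => // tb.
  have -> : t = b by apply/eqP; rewrite eq_le tb bt.
  by rewrite /g2' {1}bE subrK g2c g1b.
have pg : piecewise_smooth a d' g.
  apply: (piecewise_smooth_cat ab).
    exact: eq_piecewise_smooth e1 p1.
  exact: eq_piecewise_smooth e2 p2'.
have Ug : {in `[a, d'], forall t, U (g t)}.
  move=> t; rewrite in_itv/= => /andP[at' td'].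
  have [tb|/ltW bt] := leP t b.
    by rewrite -e1; [apply: U1|]; rewrite in_itv/= at'.
  by rewrite -e2; [apply: U2'|]; rewrite in_itv/= bt.
have ad' : a < d' := lt_trans ab bd'.
have ga : g a = x by rewrite -e1// in_itv/= lexx ltW.
have gd' : g d' = z by rewrite -e2 ?in_itv/= ?lexx ?andbT ?ltW// /g2' subrK.
rewrite -{1}ga -{1}gd' (le_trans (path_dist_le ad' pg Ug))//.
rewrite (@ge0_integral_itv_cat _ _ a b d') ?(ltW ab) ?(ltW bd')//; last 2 first.
- exact: dens_measurable.
- by move=> t /Ug; exact: dens_ge0.
rewrite -(eq_dens_integral ab p1 U1 e1) -(eq_dens_integral bd' p2' U2' e2).
have -> : (\int[mu]_(t in `[b, d']) (f (g2' t) * enorm (derive1 g2' t))%:E =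
    \int[mu]_(t in `[c, d]) (f (g2 t) * enorm (derive1 g2 t))%:E)%E.
  rewrite (@ge0_integral_shift _ _ c d m); last 2 first.
  - exact: dens_measurable.
  - by move=> t /U2; exact: dens_ge0.
  by rewrite bE; apply: eq_integral => t _; rewrite derive1_shift.
by rewrite (le_trans (leeD (ltW l1) (ltW l2)))// addeACA -EFinD -splitr.
Qed.

Lemma path_dist_sym x y :
  path_dist U (conformal f) x y = path_dist U (conformal f) y x.
Proof.
suff H u v : (path_dist U (conformal f) u v <= path_dist U (conformal f) v u)%E.
  by apply/eqP; rewrite eq_le !H.
apply: le_ereal_inf_tmp => _ [a [b [g [[ab pab] gU [<- <-] ->]]]].
rewrite path_lengthE//; pose g' t := g (- t).
have ab' : - b < - a by rewrite ltrN2.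
have p' : piecewise_smooth (- b) (- a) g' by exact: piecewise_smooth_rev.
have inN p q t : t \in `[- q, - p] -> - t \in `[p, q].
  by rewrite !in_itv/= => /andP[? ?]; lra.
have U' : {in `[- b, - a], forall t, U (g' t)} by move=> t /inN/gU.
have -> : g a = g' (- a) by rewrite /g' opprK.
have -> : g b = g' (- b) by rewrite /g' opprK.
apply: (le_trans (path_dist_le ab' p' U')); rewrite le_eqVlt; apply/predU1P; left.
have subset_U p q r s (h : R -> E3 R) : p <= r -> s <= q ->
    {in `[p, q], forall t, U (h t)} -> {in `[r, s], forall t, U (h t)}.
  move=> pr sq hU t; rewrite in_itv/= => /andP[t1 t2]; apply: hU.
  by rewrite in_itv/= (le_trans pr)// (le_trans t2).
have := gU; have := pab; have := ab.
move: (a) (b) => {pab gU p' U' ab ab'} {}a {}b ab pab.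
(* The two lengths are compared piece by piece: only inside a smooth piece is the derivative of the
   reversed path known to be minus that of the original. *)
pose P p q := {in `[p, q], forall t, U (g t)} ->
   (\int[mu]_(t in `[(- q)%R, (- p)%R]) (f (g' t) * enorm (derive1 g' t))%:E =
    \int[mu]_(t in `[p, q]) (f (g t) * enorm (derive1 g t))%:E)%E.
have P1 : forall p q (c : R^o -> E3 R), p < q -> smooth c ->
  {in `[p, q], g =1 c} -> P p q; last first.
have P2 : forall p x q, p < x -> x < q -> piecewise_smooth p x g ->
     piecewise_smooth x q g -> P p x -> P x q -> P p q; last first.
exact: (piecewise_smooth_ind P1 P2 ab pab).
- move=> p z q pz zq pw1 pw2 h1 h2 UU.
  have pw := piecewise_smooth_cat pz pw1 pw2.
  have pq := lt_trans pz zq; have pq' : - q < - p by rewrite ltrN2.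
  have UU1 : {in `[p, z], forall t, U (g t)} by exact: subset_U (lexx _) (ltW zq) UU.
  have UU2 : {in `[z, q], forall t, U (g t)} by exact: subset_U (ltW pz) (lexx _) UU.
  have UU' : {in `[- q, - p], forall t, U (g' t)} by move=> t /inN/UU.
  have qz : - q <= - z by rewrite lerN2 ltW.
  have zp : - z <= - p by rewrite lerN2 ltW.
  have m1 := dens_measurable pq pw UU.
  have m2 := dens_measurable pq' (piecewise_smooth_rev pq pw) UU'.
  have pos1 : {in `[p, q], forall t, 0 <= f (g t) * enorm (derive1 g t)}.
    by move=> t /UU; exact: dens_ge0.
  have pos2 : {in `[- q, - p], forall t, 0 <= f (g' t) * enorm (derive1 g' t)}.
    by move=> t /UU'; exact: dens_ge0.
  rewrite (ge0_integral_itv_cat (ltW pz) (ltW zq) m1 pos1).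
  by rewrite (ge0_integral_itv_cat qz zp m2 pos2) (h1 UU1) (h2 UU2) addeC.
- move=> p q c pq cS gc UU.
  have pq' : - q < - p by rewrite ltrN2.
  have pw : piecewise_smooth p q g by exact: piecewise_smooth1 gc.
  have pw' := piecewise_smooth_rev pq pw.
  have UU' : {in `[- q, - p], forall t, U (g' t)} by move=> t /inN/UU.
  rewrite [RHS]ge0_integral_opp; last 2 first.
  - exact: dens_measurable.
  - by move=> t /UU; exact: dens_ge0.
  have sub : `]- q, - p[ `<=` `[- q, - p]%classic by exact: subset_itv_oo_cc.
  have E : {in `]- q, - p[, forall t, f (g' t) * enorm (derive1 g' t) =
      f (g (- t)) * enorm (derive1 g (- t))}.
    move=> t tpq.
    suff e : enorm (derive1 g' t) = enorm (derive1 g (- t)).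
      exact: (congr1 (fun z => f (g (- t)) * z) e).
    have tpq' : - t \in `]p, q[ by move: tpq; rewrite !in_itv/= => /andP[? ?]; lra.
    have gc' : {in `[- q, - p], g' =1 fun t => c (-1 * t + 0)}.
      by move=> s /inN/gc; rewrite mulN1r addr0.
    rewrite (derive1_piece gc' tpq) (derive1_piece gc tpq').
    rewrite !derive1E derive_affine_comp mulN1r addr0 mulr1.
    have dc := cS [::] (- t).
    by rewrite !deriveE// linearN enormN.
  have mE := dens_measurable pq' pw' UU'.
  have mE1 : measurable_fun `]- q, - p[ (fun t => f (g' t) * enorm (derive1 g' t)).
    exact: measurable_funS sub mE.
  have mE2 : measurable_fun `]- q, - p[ (fun t => f (g (- t)) * enorm (derive1 g (- t))).
    apply: eq_measurable_fun mE1 => t; rewrite inE/=; exact: E.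
  exact: (eq_integral_itv_bounded true false mE1 mE2 E).
Qed.

Lemma path_dist_segment x y (M : R) :
  (forall t, 0 <= t <= 1 -> U (x + t *: (y - x)) /\ f (x + t *: (y - x)) <= M) ->
  (path_dist U (conformal f) x y <= (M * enorm (x - y))%:E)%E.
Proof.
move=> H; pose g (t : R) := x + t *: (y - x) : E3 R.
have pg : piecewise_smooth 0 1 g.
  by apply: (piecewise_smooth1 ltr01 (smooth_line x (y - x))).
have gU : {in `[0, 1], forall t, U (g t)} by move=> t; rewrite in_itv/= => /H[].
have g0 : g 0 = x by rewrite /g scale0r addr0.
have g1 : g 1 = y by rewrite /g scale1r addrC subrK.
rewrite -{1}g0 -{1}g1; apply: (le_trans (path_dist_le ltr01 pg gU)).
have dg t : derive1 g t = y - x by rewrite derive1E derive_line scale1r.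
apply: (@le_trans _ _ (\int[mu]_(t in `[0%R, 1%R]) (M * enorm (x - y))%:E)%E).
  apply: ge0_le_integral => //.
  - by move=> t /gU/dens_ge0; rewrite lee_fin.
  - by apply/measurable_EFinP; exact: dens_measurable.
  - move=> t t01; rewrite lee_fin dg enorm_distC ler_wpM2r ?enorm_ge0//.
    by move: t01; rewrite /= in_itv/= => /H[].
by rewrite integral_cst//= lebesgue_measure_itv/= lte_fin ltr01 sube0 mule1.
Qed.

End Length.

(** * Gluing metric spaces *)

Section Metrize.
Variables (R : realType) (M : Type) (d : M -> M -> R).

Record metric_axioms : Prop := MetricAxioms {
  metric_refl : forall x, d x x = 0 ;
  metric_pos : forall x y, d x y = 0 -> x = y ;
  metric_symm : forall x y, d x y = d y x ;
  metric_tri : forall y x z, d x z <= d x y + d y z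
}.

(** A copy of [M] indexed by the proof of the axioms, so that the metric structure can be found from
    the type alone. *)
Definition metrized (dP : metric_axioms) : Type := M.

Variable dP : metric_axioms.
HB.instance Definition _ := gen_eqMixin (metrized dP).
HB.instance Definition _ := gen_choiceMixin (metrized dP).
HB.instance Definition _ := isMetric.Build R (metrized dP)
  (metric_refl dP) (metric_pos dP) (metric_symm dP) (metric_tri dP).

End Metrize.

Section Glue.
Variables (R : realType) (T : Type) (X Y : set T) (a b : T -> T -> R) (e : R).
Hypothesis e_gt0 : 0 < e.
Hypothesis XY : X `<=` Y.
Hypotheses (a_refl : forall x, X x -> a x x = 0)
  (a_pos : forall x y, X x -> X y -> a x y = 0 -> x = y)
  (a_sym : forall x y, X x -> X y -> a x y = a y x)
  (a_tri : forall y x z, X x -> X y -> X z -> a x z <= a x y + a y z).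
Hypotheses (b_refl : forall x, Y x -> b x x = 0)
  (b_pos : forall x y, Y x -> Y y -> b x y = 0 -> x = y)
  (b_sym : forall x y, Y x -> Y y -> b x y = b y x)
  (b_tri : forall y x z, Y x -> Y y -> Y z -> b x z <= b x y + b y z).
Hypothesis ab : forall x y, X x -> X y -> a x y <= b x y + e.
Hypothesis ba : forall x y, X x -> X y -> b x y <= a x y + e.
Hypothesis dense : forall y, Y y -> exists2 x, X x & b x y <= e.

Let a_ge0 x y : X x -> X y -> 0 <= a x y.
Proof.
move=> Xx Xy; have := a_tri Xx Xy Xx; rewrite a_refl// (a_sym Xy Xx); lra.
Qed.

Let b_ge0 x y : Y x -> Y y -> 0 <= b x y.
Proof.
move=> Yx Yy; have := b_tri Yx Yy Yx; rewrite b_refl// (b_sym Yy Yx); lra.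
Qed.

(** The cost of going from [x] to some [z] within [X], passing to the copy of [z] in [Y] for the
    price [e], and going on to [y] within [Y]. *)
Let cross x y := inf [set a x z + b z y | z in X] + e.

Let cross_le x y z : X x -> Y y -> X z -> cross x y <= a x z + b z y + e.
Proof.
move=> Xx Yy Xz; rewrite lerD2r; apply: ge_inf; last by exists z.
by exists 0 => _ [w Xw <-]; rewrite addr_ge0 ?a_ge0 ?b_ge0//; exact: XY.
Qed.

Let le_cross c x y : X x -> Y y ->
  (forall z, X z -> c <= a x z + b z y + e) -> c <= cross x y.
Proof.
move=> Xx Yy H; rewrite -lerBlDr; apply: lb_le_inf; first by exists (a x x + b x y), x.
by move=> _ [z Xz <-]; rewrite lerBlDr H.
Qed.

(** A disjoint union, although [X] is contained in [Y]: a point of [X] and its copy in [Y] must be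
    kept apart, as they belong to different metrics. *)
Let M := ({x | X x} + {y | Y y})%type.

Let d (p q : M) : R := match p, q with
  | inl x, inl x' => a (sval x) (sval x')
  | inr y, inr y' => b (sval y) (sval y')
  | inl x, inr y => cross (sval x) (sval y)
  | inr y, inl x => cross (sval x) (sval y)
  end.

Let cross_gt0 x y : X x -> Y y -> 0 < cross x y.
Proof.
move=> Xx Yy; apply: (lt_le_trans e_gt0); apply: le_cross => // z Xz.
by rewrite lerDr addr_ge0 ?a_ge0 ?b_ge0//; exact: XY.
Qed.

Let dP : metric_axioms d.
Proof.
split.
- by move=> [[x Xx]|[x Yx]]/=; [exact: a_refl|exact: b_refl].
- move=> [[x Xx]|[x Yx]] [[y Xy]|[y Yy]]/=.
  + by move/(a_pos Xx Xy) => e'; subst y; congr inl; exact: eq_exist.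
  + by move=> h; have := cross_gt0 Xx Yy; rewrite h ltxx.
  + by move=> h; have := cross_gt0 Xy Yx; rewrite h ltxx.
  + by move/(b_pos Yx Yy) => e'; subst y; congr inr; exact: eq_exist.
- move=> [[x Xx]|[x Yx]] [[y Xy]|[y Yy]]//=; [exact: a_sym|exact: b_sym].
- have e0 := e_gt0.
  move=> [[y Xy]|[y Yy]] [[x Xx]|[x Yx]] [[z Xz]|[z Yz]]/=.
  + exact: a_tri.
  + rewrite -lerBlDl; apply: le_cross => // w Xw; rewrite lerBlDl.
    have := cross_le Xx Yz Xw; have := a_tri Xx Xy Xw; lra.
  + rewrite addrC -lerBlDl; apply: le_cross => // w Xw; rewrite lerBlDl.
    have := cross_le Xz Yx Xw; have := a_tri Xz Xy Xw; rewrite (a_sym Xz Xy); lra.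
  (* A detour from [Y] through [X] and back pays the crossing price twice, which covers the excess
     of at most [e] of [b] over [a]. The next case is the mirror image, with [ab] in place of
     [ba]. *)
  + rewrite -lerBlDl; apply: le_cross => // w Xw; rewrite lerBlDl addrC -lerBlDl.
    apply: le_cross => // v Xv; rewrite lerBlDl.
    have Yv := XY Xv; have Yw := XY Xw.
    have := b_tri Yx Yv Yz; have := b_tri Yv Yw Yz; have := ba Xv Xw.
    have := a_tri Xv Xy Xw; rewrite (a_sym Xv Xy) (b_sym Yx Yv); lra.
  + rewrite -lerBlDl; apply: le_cross => // w Xw; rewrite lerBlDl addrC -lerBlDl.
    apply: le_cross => // v Xv; rewrite lerBlDl.
    have Yv := XY Xv; have Yw := XY Xw.
    have := a_tri Xx Xv Xz; have := a_tri Xv Xw Xz; have := ab Xv Xw.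
    have := b_tri Yv Yy Yw; rewrite (a_sym Xz Xw) (b_sym Yy Yw); lra.
  + rewrite addrC -lerBlDl; apply: le_cross => // w Xw; rewrite lerBlDl.
    have Yw := XY Xw.
    have := cross_le Xx Yz Xw; have := b_tri Yw Yy Yz; lra.
  + rewrite -lerBlDl; apply: le_cross => // w Xw; rewrite lerBlDl.
    have Yw := XY Xw.
    have := cross_le Xz Yx Xw; have := b_tri Yw Yy Yx; rewrite (b_sym Yx Yy); lra.
  + exact: b_tri.
Qed.

Lemma glued_GH_dist_le : X !=set0 ->
  (GH_dist X (fun x y => (a x y)%:E) Y (fun x y => (b x y)%:E) <= (3 * e)%:E)%E.
Proof.
move=> [x0 Xx0].
pose Z : metricType R := metrized dP.
(* The maps must be total; off [X] and [Y] they take a default value that [isometric_on] never looks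
   at. *)
pose f x : Z := if pselect (X x) is left Xx then inl (exist _ x Xx)
  else inl (exist _ x0 Xx0).
pose f' y : Z := if pselect (Y y) is left Yy then inr (exist _ y Yy)
  else inl (exist _ x0 Xx0).
have fE x (Xx : X x) : f x = inl (exist _ x Xx).
  by rewrite /f; case: pselect => // Xx'; congr inl; exact: eq_exist.
have f'E y (Yy : Y y) : f' y = inr (exist _ y Yy).
  by rewrite /f'; case: pselect => // Yy'; congr inr; exact: eq_exist.
apply: (@le_trans _ _ (hausdorff_dist (f @` X) (f' @` Y))).
  apply: ereal_inf_lbound; exists Z, f, f'; split => //.
  - by move=> x y Xx Xy; rewrite (fE _ Xx) (fE _ Xy).
  - by move=> x y Xx Xy; rewrite (f'E _ Xx) (f'E _ Xy).
(* A point of [Y] is within [e] of [X] and crossing costs another [e]; the third [e] provides the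
   strict inequality in [hausdorff_dist]. *)
apply: ereal_inf_lbound; exists (3 * e) => //; have e0 := e_gt0; split => /=.
- by rewrite mulr_gt0.
- move=> _ [x Xx <-]; exists (f' x); first by exists x => //; exact: XY.
  rewrite (fE _ Xx) (f'E _ (XY Xx)).
  suff : cross x x <= e by rewrite /mdist/=; lra.
  by have := cross_le Xx (XY Xx) Xx; rewrite a_refl// b_refl ?add0r//; exact: XY.
- move=> _ [y Yy <-]; have [x Xx xy] := dense Yy; exists (f x); first by exists x.
  rewrite (fE _ Xx) (f'E _ Yy).
  suff : cross x y <= e + e by rewrite /mdist/=; lra.
  by apply: (le_trans (cross_le Xx Yy Xx)); rewrite a_refl// add0r lerD2r.
Qed.

End Glue.

Lemma eq_GH_dist (R : realType) (T T' : Type) (X : set T) (Y : set T')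
    (dX dX' : T -> T -> \bar R) (dY dY' : T' -> T' -> \bar R) :
  (forall x y, X x -> X y -> dX x y = dX' x y) ->
  (forall x y, Y x -> Y y -> dY x y = dY' x y) ->
  GH_dist X dX Y dY = GH_dist X dX' Y dY'.
Proof.
move=> eX eY; congr ereal_inf; apply/seteqP.
split=> h [Z [f [f' [iX iY ->]]]]; exists Z, f, f'; split => //.
- by move=> x y Xx Xy; rewrite -eX ?iX.
- by move=> x y Xx Xy; rewrite -eY ?iY.
- by move=> x y Xx Xy; rewrite eX ?iX.
- by move=> x y Xx Xy; rewrite eY ?iY.
Qed.

Lemma GH_dist_ge0 (R : realType) (T T' : Type) (X : set T) (Y : set T')
    (dX : T -> T -> \bar R) (dY : T' -> T' -> \bar R) :
  (0 <= GH_dist X dX Y dY)%E.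
Proof.
apply: le_ereal_inf_tmp => _ [Z [f [f' [_ _ ->]]]].
by apply: le_ereal_inf_tmp => _ [e [e0 _ _] <-]; rewrite lee_fin ltW.
Qed.

(** * Integrability of the singular kernel *)

Section Measurability.
Variable R : realType.
Notation M3 := (measurableTypeR R * measurableTypeR R * measurableTypeR R)%type.

Lemma measurable_coord : [/\ measurable_fun [set: M3] (fun y : M3 => y.1.1 : R),
  measurable_fun [set: M3] (fun y : M3 => y.1.2 : R) &
  measurable_fun [set: M3] (fun y : M3 => y.2 : R)].
Proof.
split; last exact: measurable_snd.
- exact: (measurableT_comp measurable_fst measurable_fst).
- exact: (measurableT_comp measurable_snd measurable_fst).
Qed.

Lemma measurable_invr : measurable_fun [set: R] (fun r : R => `|r|^-1).
Proof.
have -> : (fun r : R => `|r|^-1) = (fun r => @powR R r (-1)) \o (@Num.norm R R).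
  by apply/funext => r /=; rewrite powR_inv1.
by apply: measurableT_comp; [exact: measurable_powR|exact: normr_measurable].
Qed.

Lemma measurable_enorm (x : E3 R) :
  measurable_fun [set: M3] (fun y : M3 => enorm (x - (y : E3 R))).
Proof.
have [m1 m2 m3] := measurable_coord.
apply: (@measurableT_comp _ _ _ _ _ _ (Num.sqrt : R -> R) _ (fun y : M3 =>
  (x.1.1 - y.1.1) * (x.1.1 - y.1.1) + (x.1.2 - y.1.2) * (x.1.2 - y.1.2) +
  (x.2 - y.2) * (x.2 - y.2))).
  by apply: continuous_measurable_fun; exact: sqrt_continuous.
by apply: measurable_funD; [apply: measurable_funD|];
  apply: measurable_funM; apply: measurable_funB.
Qed.

Lemma measurable_inv_enorm (x : E3 R) :
  measurable_fun [set: M3] (fun y : M3 => (enorm (x - (y : E3 R)))^-1).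
Proof.
have -> : (fun y : M3 => (enorm (x - (y : E3 R)))^-1) =
    (fun r : R => `|r|^-1) \o (fun y : M3 => enorm (x - (y : E3 R))).
  by apply/funext => y /=; rewrite ger0_norm// enorm_ge0.
exact: (measurableT_comp measurable_invr (measurable_enorm x)).
Qed.

(** The domain carries the product sigma-algebra, so the preimages are exhibited through boxes: [A]
    is the pointwise limit of its values at the points obtained by rounding each coordinate down to
    a multiple of 1/(n+1), and each of these functions is constant on the boxes of a countable
    grid. *)
Lemma continuous_measurable3 (A : E3 R -> R) : continuous A ->
  measurable_fun [set: M3] (A : M3 -> R).
Proof.
move=> cA.
pose q n (t : R) : R := (Num.floor (t * n.+1%:R))%:~R / n.+1%:R.
pose Q n (y : M3) : E3 R := (q n y.1.1, q n y.1.2, q n y.2).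
apply: (@measurable_fun_cvg _ _ _ _ (fun n y => A (Q n y))); last first.
  move=> y _; apply: (@cvg_comp _ _ _ (Q ^~ y) A _ _ _ _ (cA y)).
  have qcvg t : q n t @[n --> \oo] --> t.
    apply/cvgrPdist_lt => e e0; near=> n.
    rewrite /q ltr_norml.
    have n0 : (0 : R) < n.+1%:R by rewrite ltr0n.
    rewrite -[X in X - _ / _](mulfK (lt0r_neq0 n0) t) -mulrBl; set z := t * n.+1%:R.
    have /andP[h1 h2] : (Num.floor z)%:~R <= z < (Num.floor z)%:~R + 1.
      by have := floor_itv z; rewrite intrD.
    rewrite ltr_pdivlMr// ltr_pdivrMr//.
    have : n.+1%:R^-1 < e by near: n; exact: near_infty_natSinv_lt (PosNum e0).
    rewrite -div1r ltr_pdivrMr// => en.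
    by apply/andP; split; lra.
  case: y => -[y1 y2] y3.
  have H1 : (fun n => (q n y1, q n y2)) @ \oo --> (y1, y2).
    exact: (cvg_pair (qcvg y1) (qcvg y2)).
  exact: (cvg_pair H1 (qcvg y3)).
move=> n _ B mB; rewrite setTI.
pose c i : R := i%:~R / n.+1%:R.
pose V i : set R := [set t | Num.floor (t * n.+1%:R) = i].
have mV i : measurable (V i).
  rewrite (_ : V i = `[c i, c (i + 1)[%classic); first exact: measurable_itv.
  apply/seteqP; split => t; rewrite /V /c /= in_itv/= ler_pdivrMr// ltr_pdivlMr//.
    by move=> <-; exact: floor_itv.
  by move=> h; apply: floor_def; rewrite h.
rewrite (_ : _ @^-1` _ = \bigcup_(i in [set i : int * int * int | B (A (c i.1.1, c i.1.2, c i.2))])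
    (V i.1.1 `*` V i.1.2 `*` V i.2)).
  rewrite bigcup_mkcond; apply: countable_bigcupT_measurable; first exact: countableP.
  by move=> i; case: ifP => // _; apply: measurableX; [apply: measurableX|]; exact: mV.
apply/seteqP; split.
  move=> y /= By; exists (Num.floor (y.1.1 * n.+1%:R), Num.floor (y.1.2 * n.+1%:R), Num.floor (y.2 * n.+1%:R)) => //.
by move=> y [[[i j] k]/= Bi [[/= h1 h2] h3]]; rewrite /Q /q h1 h2 h3.
Unshelve. all: by end_near. Qed.


Definition dyadic_cube (x : E3 R) (k : nat) : set M3 :=
  `[x.1.1 - 2^-1 ^+ k, x.1.1 + 2^-1 ^+ k] `*`
  `[x.1.2 - 2^-1 ^+ k, x.1.2 + 2^-1 ^+ k] `*`
  `[x.2 - 2^-1 ^+ k, x.2 + 2^-1 ^+ k].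

Lemma dyadic_cubeE x k (y : M3) : dyadic_cube x k y <->
  [/\ `|x.1.1 - y.1.1| <= 2^-1 ^+ k, `|x.1.2 - y.1.2| <= 2^-1 ^+ k &
      `|x.2 - y.2| <= 2^-1 ^+ k].
Proof.
have E (a b c : R) : (b \in `[a - c, a + c]) = (`|a - b| <= c).
  by rewrite in_itv/= ler_norml; apply/idP/idP => /andP[? ?]; apply/andP; split; lra.
rewrite /dyadic_cube /= !E; split; first by case=> [[]].
by case=> *; split.
Qed.

Lemma lebesgue3_box (a1 b1 a2 b2 a3 b3 : R) (u1 v1 u2 v2 u3 v3 : bool) :
  a1 <= b1 -> a2 <= b2 -> a3 <= b3 ->
  lebesgue3 R ([set` Interval (BSide u1 a1) (BSide v1 b1)] `*`
             [set` Interval (BSide u2 a2) (BSide v2 b2)] `*`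
             [set` Interval (BSide u3 a3) (BSide v3 b3)]) =
  ((b1 - a1) * (b2 - a2) * (b3 - a3))%:E.
Proof.
have E (a b : R) u v : a <= b ->
    lebesgue_measure [set` Interval (BSide u a) (BSide v b)] = (b - a)%:E.
  rewrite le_eqVlt lebesgue_measure_itv/= lte_fin => /predU1P[->|->]//.
  by rewrite ltxx subrr.
move=> h1 h2 h3.
pose I1 : set (measurableTypeR R) := [set` Interval (BSide u1 a1) (BSide v1 b1)].
pose I2 : set (measurableTypeR R) := [set` Interval (BSide u2 a2) (BSide v2 b2)].
pose I3 : set (measurableTypeR R) := [set` Interval (BSide u3 a3) (BSide v3 b3)].
have m1 : measurable I1 by exact: measurable_itv.
have m2 : measurable I2 by exact: measurable_itv.
have m3 : measurable I3 by exact: measurable_itv.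
have m12 : measurable (I1 `*` I2) by exact: measurableX.
have h12 := product_measure1E (@lebesgue_measure R) (@lebesgue_measure R) m1 m2.
have h123 := product_measure1E (@lebesgue_measure R \x @lebesgue_measure R)%E
  (@lebesgue_measure R) m12 m3.
apply: (etrans h123); apply: (etrans (congr2 mule
  (etrans h12 (congr2 mule (E _ _ u1 v1 h1) (E _ _ u2 v2 h2))) (E _ _ u3 v3 h3))).
by rewrite -!EFinM.
Qed.

Lemma measurable_dyadic_cube x k : measurable (dyadic_cube x k).
Proof. by apply: measurableX => //; exact: measurableX. Qed.

(* A dyadic majorant of [|x - y|^-2], equal to [+oo] on the diagonal so that
   the junk value [0^-1 = 0] there is harmless. *)
Definition inv_sqr_majorant (x : E3 R) (y : M3) : \bar R :=
  (1 + \sum_(0 <= k <oo) (4 ^+ k.+1 * \1_(dyadic_cube x k) y)%:E)%E.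

(** If |x - y| lies between 2^-(k+1) and 2^-k, then [y] is in the k-th cube and its weight 4^(k+1)
    exceeds |x - y|^-2. Distances from 1 on are covered by the summand 1. On the diagonal every cube
    contributes, so any real [c] is dominated and the premise can be confined to [x != y]. *)
Lemma inv_sqr_majorant_ge (x : E3 R) (y : M3) (c kappa : R) : 0 < kappa ->
  (x != y -> c <= kappa * (enorm (x - (y : E3 R)))^-2) ->
  (c%:E <= kappa%:E * inv_sqr_majorant x y)%E.
Proof.
move=> k0 H.
have term_ge0 k : (0 <= (4 ^+ k.+1 * \1_(dyadic_cube x k) y : R)%:E)%E.
  by rewrite lee_fin mulr_ge0// exprn_ge0.
have majorant_ge k : dyadic_cube x k y ->
    ((4 ^+ k.+1 : R)%:E <= inv_sqr_majorant x y)%E.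
  move=> xky; apply: (@le_trans _ _ (\sum_(0 <= k <oo) (4 ^+ k.+1 * \1_(dyadic_cube x k) y : R)%:E)%E).
    apply: le_trans (nneseries_lim_ge k.+1 _) => //.
    rewrite big_nat_recr//= indicE mem_set// mulr1 leeDr// sume_ge0//.
  by rewrite /inv_sqr_majorant leeDr.
have majorant_ge1 : (1 <= inv_sqr_majorant x y)%E.
  by rewrite /inv_sqr_majorant leeDl// nneseries_ge0.
have [xy|xy] := eqVneq x (y : E3 R).
  have [k ck] : exists k, c / kappa <= 4 ^+ k.+1.
    exists (Num.bound `|c / kappa|).
    apply: (le_trans (ler_norm _)); apply: (le_trans (ltW (archi_boundP _))) => //.
    by rewrite -natrX ler_nat (leq_trans (ltnW (ltn_expl _ (isT : (1 < 4)%N))))// leq_exp2l.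
  have h := majorant_ge k; rewrite ler_pdivrMr// mulrC in ck.
  apply: (@le_trans _ _ (kappa * 4 ^+ k.+1)%:E); first by rewrite lee_fin.
  rewrite EFinM lee_pmul2l// h//; apply/dyadic_cubeE.
  by rewrite xy !subrr normr0 exprn_ge0.
apply: (@le_trans _ _ (kappa * (enorm (x - (y : E3 R)))^-2)%:E).
  by rewrite lee_fin H.
rewrite EFinM lee_pmul2l//.
have [h1 h2 h3] := enorm_ge_coord (x - (y : E3 R)).
have e0 : 0 < enorm (x - (y : E3 R)).
  rewrite lt_neqAle enorm_ge0 andbT; apply: contra xy => /eqP/esym/enorm_eq0/eqP.
  by rewrite subr_eq0.
have [e1|e1] := leP 1 (enorm (x - (y : E3 R))).
  apply: le_trans majorant_ge1; rewrite lee_fin invf_le1 ?exprn_gt0//.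
  by rewrite exprn_ege1.
have exk : exists k, 2^-1 ^+ k.+1 < enorm (x - (y : E3 R)).
  exists (Num.bound (enorm (x - (y : E3 R)))^-1).
  rewrite exprVn -[ltRHS]invrK ltf_pV2 ?posrE ?exprn_gt0 ?invr_gt0//.
  apply: (lt_le_trans (archi_boundP _)); first by rewrite invr_ge0 ltW.
  by rewrite -natrX ler_nat (leq_trans (ltnW (ltn_expl _ (isT : (1 < 2)%N))))// leq_exp2l.
(* Minimality of [k] gives the upper bound 2^-k on the distance; for [k = 0] it is the assumption
   that the distance is below 1. *)
have [k hk' hmin] := ex_minnP exk.
have hk2 : enorm (x - (y : E3 R)) <= 2^-1 ^+ k.
  case: k hk' hmin => [|k] _ hmin; first by rewrite expr0 ltW.
  by rewrite leNgt; apply/negP => /hmin; rewrite ltnn.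
apply: le_trans (majorant_ge k _); last first.
  by apply/dyadic_cubeE; split; apply: (le_trans _ hk2).
rewrite lee_fin -[leRHS]invrK lef_pV2 ?posrE ?invr_gt0 ?exprn_gt0//.
have -> : (4 ^+ k.+1)^-1 = (2^-1 ^+ k.+1) ^+ 2 :> R.
  by rewrite -exprM mulnC exprM -exprVn; congr (_ ^+ _); field.
by rewrite ler_pXn2r ?nnegrE ?ltW// exprn_ge0.
Qed.

Lemma measurable_inv_sqr_majorant x :
  measurable_fun [set: M3] (inv_sqr_majorant x).
Proof.
have cst1 : measurable_fun [set: M3] (cst 1%E : M3 -> \bar R) by exact: measurable_cst.
apply: (emeasurable_funD cst1).
apply: (@ge0_emeasurable_sum _ _ _ _
  (fun k (y : M3) => (4 ^+ k.+1 * \1_(dyadic_cube x k) y : R)%:E) predT).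
  by move=> k y _ _; rewrite lee_fin mulr_ge0// exprn_ge0.
move=> k _; apply/measurable_EFinP/measurable_funM => //.
by apply: measurable_indic; exact: measurable_dyadic_cube.
Qed.

Lemma inv_sqr_majorant_ge0 x y : (0 <= inv_sqr_majorant x y)%E.
Proof.
by rewrite adde_ge0// nneseries_ge0.
Qed.

(** The k-th cube has volume 8 * 8^-k and weight 4^(k+1), so it contributes at most 32 * 2^-k; these
    bounds sum to 64, whatever the pole. *)
Lemma integral_inv_sqr_majorant x (Q : set M3) : measurable Q ->
  (\int[lebesgue3 R]_(y in Q) inv_sqr_majorant x y <= lebesgue3 R Q + 64%:E)%E.
Proof.
move=> mQ.
have m k : measurable_fun Q (fun y : M3 => (4 ^+ k.+1 * \1_(dyadic_cube x k) y : R)%:E).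
  apply/measurable_EFinP/measurable_funM => //.
  by apply: measurable_indic; exact: measurable_dyadic_cube.
have p k y : (0 <= (4 ^+ k.+1 * \1_(dyadic_cube x k) y : R)%:E)%E.
  by rewrite lee_fin mulr_ge0// exprn_ge0.
rewrite ge0_integralD//; last 2 first.
- by move=> y _; exact: nneseries_ge0.
- exact: (@ge0_emeasurable_sum _ _ _ _ (fun k (y : M3) => (4 ^+ k.+1 * \1_(dyadic_cube x k) y : R)%:E) predT).
rewrite integral_cst// mul1e leeD2l// integral_nneseries//.
(* The bound 32 * 2^-k, written in the shape of the halving geometric series summed at the end. *)
have step k : (\int[lebesgue3 R]_(y in Q) (4 ^+ k.+1 * \1_(dyadic_cube x k) y : R)%:E
    <= (64 / (2 ^ (k + 0.+1))%:R)%:E)%E.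
  under eq_integral do rewrite EFinM.
  have mI : measurable_fun Q (fun y : M3 => (\1_(dyadic_cube x k) y : R)%:E).
    by apply/measurable_EFinP; apply: measurable_indic; exact: measurable_dyadic_cube.
  rewrite (ge0_integralZl _ mQ mI) ?lee_fin ?exprn_ge0//.
  rewrite integral_indic//; last exact: measurable_dyadic_cube.
  apply: (@le_trans _ _ ((4 ^+ k.+1 : R)%:E * lebesgue3 R (dyadic_cube x k))%E).
    rewrite lee_pmul2l ?lte_fin ?exprn_gt0//.
    apply: le_measure; rewrite ?inE//.
    - by apply: measurableI => //; exact: measurable_dyadic_cube.
    - exact: measurable_dyadic_cube.
  have h : (0 : R) <= 2^-1 ^+ k by rewrite exprn_ge0.
  rewrite lebesgue3_box; [|lra..].
  rewrite -EFinM lee_fin le_eqVlt; apply/orP; left; apply/eqP.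
  have -> : 64 / (2 ^ (k + 0.+1))%:R = 32 * 2^-1 ^+ k :> R.
    rewrite addn1 natrX exprS exprVn; by field; rewrite expf_neq0.
  have e4 : 4 ^+ k * (2^-1 ^+ k) ^+ 2 = 1 :> R.
    by rewrite -exprM mulnC exprM -exprMn (_ : 4 * _ = 1) ?expr1n//; field.
  by rewrite exprS; ring: e4.
apply: (le_trans (lee_nneseries _ (fun k _ => step k))) => //.
  by move=> k _ _; apply: integral_ge0.
rewrite (cvg_lim _ (@cvg_geometric_eseries_half R 64 0))//.
by rewrite expr0 divr1.
Qed.

End Measurability.

(** * Newtonian potentials *)

Lemma norm_le_enorm (R : realType) (v : E3 R) : `|v| <= enorm v.
Proof.
have [h1 h2 h3] := enorm_ge_coord v.
by rewrite prod_normE ge_max h3 andbT prod_normE ge_max h1.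
Qed.

Section Potential.
Variables (R : realType) (D : R) (A : E3 R -> R).
Hypothesis D_gt0 : 0 < D.
Hypothesis cA : continuous A.
Hypothesis A_supp : supported_in (cube D) A.
Notation M3 := (measurableTypeR R * measurableTypeR R * measurableTypeR R)%type.

(** Half-open so that the half-open cells around the box centers tile it exactly. *)
Definition half_open_cube : set M3 := `[- D, D[ `*` `[- D, D[ `*` `[- D, D[.

Lemma measurable_half_open_cube : measurable half_open_cube.
Proof. by apply: measurableX => //; exact: measurableX. Qed.

Lemma lebesgue3_half_open_cube : lebesgue3 R half_open_cube = (8 * D ^+ 3)%:E.
Proof.
have DD : - D <= D by have := D_gt0; lra.
by rewrite /half_open_cube lebesgue3_box//; congr EFin; ring.
Qed.

Lemma vanish_off_cube y : ~ cube D y -> A y = 0.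
Proof.
move=> yC; apply/eqP; apply: contrapT => /negP Ay; apply: yC.
by apply: A_supp; exact: subset_closure.
Qed.

(* A nonzero value at a boundary point would persist slightly outside the cube. *)
Lemma vanish_off_half_open_cube (y : M3) : ~ half_open_cube y -> A y = 0.
Proof.
move=> yQ; have [yC|] := pselect (cube D (y : E3 R)); last exact: vanish_off_cube.
apply/eqP; apply: contrapT => /negP Ay.
have out (v : E3 R) : (forall t : R, 0 < t -> ~ cube D ((y : E3 R) + t *: v)) -> False.
  move=> H.
  have cg : (fun t : R => A ((y : E3 R) + t *: v)) @ 0 --> A y.
    apply: (@cvg_comp _ _ _ (fun t : R => (y : E3 R) + t *: v) A); last exact: cA.
    have : (fun t : R => (y : E3 R) + t *: v) @ 0 --> (y : E3 R) + 0 *: v.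
      by apply: cvgD; [exact: cvg_cst|apply: cvgZr_tmp; exact: cvg_id].
    by rewrite scale0r addr0.
  have /cvg_at_right_filter cg' := cg.
  have : \forall t \near 0^'+, A ((y : E3 R) + t *: v) != 0.
    by apply: (cvgr_neq0 _ cg') => //; exact/eqP.
  have n0 : \forall t \near (0 : R)^'+, 0 < t by exact: nbhs_right_gt.
  move=> n1; have [t [t0 At]] := filter_ex (filterI n0 n1).
  by move/eqP: At; apply; apply: vanish_off_cube; exact: H.
case: yC; rewrite !ler_norml => /andP[a1 b1] /andP[a2 b2] /andP[a3 b3].
have [e1|n1] := eqVneq y.1.1 D.
  apply: (out (1, 0, 0)) => t t0 [/=]; rewrite /GRing.scale/= mulr1 e1.
  by rewrite ger0_norm; have := D_gt0; lra.
have [e2|n2] := eqVneq y.1.2 D.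
  apply: (out (0, 1, 0)) => t t0 [/= _]; rewrite /GRing.scale/= mulr1 e2.
  by rewrite ger0_norm; have := D_gt0; lra.
have [e3|n3] := eqVneq y.2 D.
  apply: (out (0, 0, 1)) => t t0 [/= _ _]; rewrite /GRing.scale/= mulr1 e3.
  by rewrite ger0_norm; have := D_gt0; lra.
by apply: yQ; split; [split|]; rewrite /= in_itv/= lt_neqAle; apply/and3P; split.
Qed.

Lemma compact_cube : compact (cube D).
Proof.
have -> : cube D = `[- D, D] `*` `[- D, D] `*` `[- D, D] :> set (E3 R).
  apply/seteqP; split => y /=; rewrite !in_itv/= -!ler_norml; first by case.
  by case=> -[].
by apply: compact_setX; first apply: compact_setX; exact: segment_compact.
Qed.

Lemma bounded_density : exists2 M, 0 < M & forall y, A y <= M.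
Proof.
have := @compact_bounded R R^o (A @` cube D) (continuous_compact (continuous_subspaceT cA) compact_cube).
move=> [M [_ HM]]; exists (`|M| + 1); first by rewrite ltr_pwDr.
move=> y; have [yC|/vanish_off_cube ->] := pselect (cube D y); last by rewrite addr_ge0.
have M1 : M < `|M| + 1 by rewrite (le_lt_trans (ler_norm M))// ltrDl.
apply: (le_trans (ler_norm _)); apply: (HM _ M1); by exists y.
Qed.

(** Only [p] is confined to the compact cube, because a point [y] near it may lie outside.
    Compactness is used in its near-covering form: every [x] has a neighbourhood and a radius that
    work together. *)
Lemma unif_continuous_density (eta : R) : 0 < eta ->
  exists2 delta, 0 < delta & forall p y : E3 R, cube D p -> enorm (y - p) < delta ->
    `|A y - A p| <= eta.
Proof.
move=> eta0.
have /compact_near_coveringP := compact_cube.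
move=> /(_ R (0 : R)^'+ (fun d p => forall y : E3 R, enorm (y - p) < d -> `|A y - A p| <= eta) _).
move=> [].
  move=> x _; have eta2 : 0 < eta / 2 by rewrite divr_gt0.
  have /cvgrPdist_lt/(_ _ eta2) := @cA x.
  move=> /nbhs_ballP[e /= e0 He].
  have e20 : 0 < e / 2 by rewrite divr_gt0.
  have ball_lt (u : E3 R) : `|x - u| < e -> `|A x - A u| < eta / 2.
    by move=> xu; apply: He; rewrite -ball_normE.
  near=> p d => y ypd.
  have d2 : d < e / 2 by near: d; exact: nbhs_right_lt.
  have xp : `|x - p| < e / 2 by near: p; apply: cvgr_dist_lt.
  have h1 := ball_lt p; have h2 := ball_lt y.
  have yp : `|y - p| < e / 2.
    by rewrite (le_lt_trans (norm_le_enorm _))// (lt_trans ypd).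
  have xy : `|x - y| < e.
    rewrite (splitr e) (le_lt_trans (ler_distD p _ _))// ltrD//.
    by rewrite distrC.
  rewrite (le_trans (ler_distD (A x) _ _))// (splitr eta) lerD//.
    by rewrite distrC ltW// h2.
  by rewrite ltW// h1// (lt_trans xp)// gtr_pMr// invf_lt1// ltr1n.
move=> d /= d0 Hd; exists (d / 2); first by rewrite divr_gt0.
move=> p y pC ypd; apply: (Hd (d / 2)) ypd => //=.
  by rewrite sub0r normrN gtr0_norm ?divr_gt0// gtr_pMr// invf_lt1// ltr1n.
by rewrite divr_gt0.
Unshelve. all: by end_near. Qed.

End Potential.

Section PotentialEstimates.
Variables (R : realType) (D : R) (A : E3 R -> R) (M : R).
Hypothesis D_gt0 : 0 < D.
Hypothesis cA : continuous A.
Hypothesis A_supp : supported_in (cube D) A.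
Hypothesis A_ge0 : forall y, 0 <= A y.
Hypothesis M_gt0 : 0 < M.
Hypothesis A_le : forall y, A y <= M.
Notation M3 := (measurableTypeR R * measurableTypeR R * measurableTypeR R)%type.
Notation mu := (lebesgue3 R).
Notation Q := (half_open_cube D).

(** Bounds the integral of |x - y|^-2 over the cube for every [x]: the volume of the cube plus the
    64 of the dyadic series. *)
Definition kernel_bound : R := 8 * D ^+ 3 + 64.

Lemma kernel_bound_gt0 : 0 < kernel_bound.
Proof. by rewrite /kernel_bound ltr_wpDl// mulr_ge0// exprn_ge0// ltW. Qed.

Let mQ : measurable Q := measurable_half_open_cube D.

Lemma integral_majorant_le (kappa : R) x : 0 <= kappa ->
  (\int[mu]_(y in Q) (kappa%:E * inv_sqr_majorant x y) <= (kappa * kernel_bound)%:E)%E.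
Proof.
move=> k0.
have mW : measurable_fun Q (inv_sqr_majorant x).
  exact: measurable_funS (measurable_inv_sqr_majorant x).
rewrite (ge0_integralZl _ mQ mW) ?lee_fin//; last by move=> y _; exact: inv_sqr_majorant_ge0.
rewrite EFinM lee_wpmul2l ?lee_fin//.
apply: (le_trans (integral_inv_sqr_majorant _ mQ)).
by rewrite lebesgue3_half_open_cube// /kernel_bound.
Qed.

Lemma integrable_majorized (f : M3 -> R) (kappa : R) x :
  measurable_fun Q f -> 0 < kappa ->
  (forall y, Q y -> x != (y : E3 R) ->
    `|f y| <= kappa * (enorm (x - (y : E3 R)))^-2) ->
  mu.-integrable Q (EFin \o f).
Proof.
move=> mf k0 fk; apply/integrableP; split; first exact/measurable_EFinP.
apply: (@le_lt_trans _ _ (\int[mu]_(y in Q) (kappa%:E * inv_sqr_majorant x y))%E); last first.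
  by apply: (le_lt_trans (integral_majorant_le x (ltW k0))); exact: ltry.
apply: ge0_le_integral => //.
- by apply: measurableT_comp => //; exact/measurable_EFinP.
- apply: measurable_funeM; exact: measurable_funS (measurable_inv_sqr_majorant x).
- by move=> y Qy; rewrite inv_sqr_majorant_ge// => xy; exact: fk.
Qed.

(** The majorant [W] is extended-valued so that it may be infinite at the poles. *)
Lemma Rintegral_dist_le (f1 f2 : M3 -> R) (W : M3 -> \bar R) (c : R) :
  mu.-integrable Q (EFin \o f1) -> mu.-integrable Q (EFin \o f2) ->
  measurable_fun Q W -> (forall y, Q y -> (`|f1 y - f2 y|%:E <= W y)%E) ->
  (\int[mu]_(y in Q) W y <= c%:E)%E ->
  `|\int[mu]_(y in Q) f1 y - \int[mu]_(y in Q) f2 y| <= c.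
Proof.
move=> i1 i2 mW fW Wc; rewrite -RintegralB//.
have i12 : mu.-integrable Q (EFin \o (fun y => f1 y - f2 y)).
  rewrite (_ : _ \o _ = (EFin \o f1) \- (EFin \o f2))%E; last by apply/funext.
  exact: integrableB.
apply: (le_trans (le_normr_Rintegral mQ i12)).
have m12 : measurable_fun Q (fun y => f1 y - f2 y).
  by have /integrableP[/measurable_EFinP] := i12.
have H : (\int[mu]_(y in Q) `|f1 y - f2 y|%:E <= c%:E)%E.
  apply: le_trans Wc; apply: ge0_le_integral => //.
  by apply/measurable_EFinP; apply: measurableT_comp => //; exact: normr_measurable.
rewrite -lee_fin /Rintegral fineK// fin_real// (le_lt_trans H) ?ltry// andbT.
by rewrite (lt_le_trans _ (integral_ge0 _ _))// => y _; rewrite lee_fin.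
Qed.

Lemma measurable_newton x : measurable_fun Q (fun y : M3 => A y / enorm (x - (y : E3 R))).
Proof.
apply: measurable_funM.
  exact: measurable_funS (continuous_measurable3 cA).
exact: measurable_funS (measurable_inv_enorm x).
Qed.

Lemma limit_factorE x :
  limit_factor A x = 1 + \int[mu]_(y in Q) (A y / enorm (x - (y : E3 R))).
Proof.
rewrite /limit_factor; congr (_ + _); rewrite [RHS]Rintegral_mkcond.
apply: eq_Rintegral => y _; rewrite patchE; case: ifPn => // /negP yQ.
rewrite (@vanish_off_half_open_cube _ D A) ?mul0r//.
by move=> Qy; apply: yQ; rewrite inE.
Qed.

Lemma half_open_cube_enorm (y : M3) : Q y -> enorm (y : E3 R) <= 2 * D.
Proof.
case=> [[/=]]; rewrite !in_itv/= => h1 h2 h3.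
apply: (@le_trans _ _ (Num.sqrt 3 * D)).
  by apply: enorm_le_coord; rewrite ler_norml; case/andP: h1 h2 h3 => ? ? /andP[? ?] /andP[? ?]; lra.
rewrite ler_pM2r// -[leRHS]ger0_norm// -sqrtr_sqr ler_sqrt; lra.
Qed.

(** As |x - y| is at most L + 2D, the Newtonian kernel is dominated by the square kernel, and the
    same majorant serves for it. *)
Lemma newton_le (L : R) x (y : M3) : 0 < L -> enorm x <= L -> Q y -> x != (y : E3 R) ->
  (enorm (x - (y : E3 R)))^-1 <= (L + 2 * D) * (enorm (x - (y : E3 R)))^-2.
Proof.
move=> L0 xL Qy xy.
have e0 : 0 < enorm (x - (y : E3 R)).
  rewrite lt_neqAle enorm_ge0 andbT; apply: contra xy => /eqP/esym/enorm_eq0/eqP.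
  by rewrite subr_eq0.
rewrite expr2 invfM mulrA ler_peMl ?invr_ge0 ?enorm_ge0//.
rewrite ler_pdivlMr// mul1r (le_trans (enormD _ _))// enormN lerD//.
exact: half_open_cube_enorm.
Qed.

Lemma integrable_newton x : mu.-integrable Q (EFin \o (fun y : M3 => A y / enorm (x - (y : E3 R)))).
Proof.
have L0 : 0 < enorm x + 1 by rewrite ltr_wpDl// enorm_ge0.
apply: (@integrable_majorized _ (M * (enorm x + 1 + 2 * D)) x).
- exact: measurable_newton.
- by rewrite mulr_gt0// addr_gt0// mulr_gt0.
- move=> y Qy xy; rewrite ger0_norm ?mulr_ge0 ?invr_ge0 ?enorm_ge0//.
  rewrite -mulrA ler_pM ?invr_ge0 ?enorm_ge0//; apply: newton_le => //.
  by rewrite lerDl.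
Qed.

Lemma limit_factor_ge1 x : 1 <= limit_factor A x.
Proof.
rewrite limit_factorE lerDl Rintegral_ge0// => y _.
by rewrite mulr_ge0// invr_ge0 enorm_ge0.
Qed.

Lemma limit_factor_le (L : R) x : 0 < L -> enorm x <= L ->
  limit_factor A x <= 1 + M * (L + 2 * D) * kernel_bound.
Proof.
move=> L0 xL; rewrite limit_factorE lerD2l.
have k0 : 0 < M * (L + 2 * D) by rewrite mulr_gt0// addr_gt0// mulr_gt0.
have := @Rintegral_dist_le (fun y : M3 => A y / enorm (x - (y : E3 R))) (cst 0)
  (fun y => (M * (L + 2 * D))%:E * inv_sqr_majorant x y)%E (M * (L + 2 * D) * kernel_bound)
  (integrable_newton x).
rewrite Rintegral_cst// mul0r subr0 => H; apply: (le_trans (ler_norm _)); apply: H.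
- exact: integrable0.
- apply: measurable_funeM; exact: measurable_funS (measurable_inv_sqr_majorant x).
- move=> y Qy; apply: inv_sqr_majorant_ge => // xy; rewrite subr0.
  rewrite ger0_norm ?mulr_ge0 ?invr_ge0 ?enorm_ge0//.
  rewrite -mulrA ler_pM ?invr_ge0 ?enorm_ge0//; exact: newton_le.
- exact/integral_majorant_le/ltW.
Qed.

(* [|1/a - 1/b| <= |x - x'| / (a b)] with [a = |x - y|], [b = |x' - y|], and
   [1 / (a b) <= (a^-2 + b^-2) / 2]. *)
Lemma limit_factor_lipschitz x x' :
  `|limit_factor A x - limit_factor A x'| <= M * kernel_bound * enorm (x - x').
Proof.
have [->|xx'] := eqVneq x x'; first by rewrite !subrr normr0 enorm0 mulr0.
have d0 : 0 < enorm (x - x').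
  rewrite lt_neqAle enorm_ge0 andbT; apply: contra xx' => /eqP/esym/enorm_eq0/eqP.
  by rewrite subr_eq0.
have -> : limit_factor A x - limit_factor A x' =
   \int[mu]_(y in Q) (A y / enorm (x - (y : E3 R))) -
   \int[mu]_(y in Q) (A y / enorm (x' - (y : E3 R))).
  by rewrite !limit_factorE; ring.
pose k := M * enorm (x - x') / 2.
have k0 : 0 < k by rewrite /k !mulr_gt0.
have mW z : measurable_fun Q (fun y => k%:E * inv_sqr_majorant z y)%E.
  apply: measurable_funeM; exact: measurable_funS (measurable_inv_sqr_majorant z).
apply: (@Rintegral_dist_le _ _ (fun y => k%:E * inv_sqr_majorant x y + k%:E * inv_sqr_majorant x' y)%E).
- exact: integrable_newton.
- exact: integrable_newton.
- exact: emeasurable_funD.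
- move=> y Qy.
  (* At [y = x] or [y = x'] a single majorant already dominates every real, so the estimate is
     needed only off both poles. *)
  have split_le (c : R) : (x != (y : E3 R) -> x' != (y : E3 R) ->
      c <= k * (enorm (x - (y : E3 R)))^-2 + k * (enorm (x' - (y : E3 R)))^-2) ->
    (c%:E <= k%:E * inv_sqr_majorant x y + k%:E * inv_sqr_majorant x' y)%E.
    move=> H.
    have pos z : (0 <= k%:E * inv_sqr_majorant z y)%E.
      by rewrite mule_ge0 ?lee_fin ?(ltW k0)//; exact: inv_sqr_majorant_ge0.
    have [xy|xy] := eqVneq x (y : E3 R).
      rewrite (@le_trans _ _ (k%:E * inv_sqr_majorant x y)%E)// ?leeDl//.
      by apply: inv_sqr_majorant_ge => //; rewrite xy eqxx.
    have [xy'|xy'] := eqVneq x' (y : E3 R).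
      rewrite (@le_trans _ _ (k%:E * inv_sqr_majorant x' y)%E)// ?leeDr//.
      by apply: inv_sqr_majorant_ge => //; rewrite xy' eqxx.
    apply: (@le_trans _ _ (k * (enorm (x - (y : E3 R)))^-2 + k * (enorm (x' - (y : E3 R)))^-2)%:E).
      by rewrite lee_fin; exact: H.
    by rewrite EFinD leeD//; exact: inv_sqr_majorant_ge.
  apply: split_le => xy xy'.
  have e z : z != (y : E3 R) -> 0 < enorm (z - (y : E3 R)).
    move=> zy; rewrite lt_neqAle enorm_ge0 andbT; apply: contra zy => /eqP/esym/enorm_eq0/eqP.
    by rewrite subr_eq0.
  have a0 := e _ xy; have b0 := e _ xy'.
  set a := enorm (x - (y : E3 R)) in a0 *; set b := enorm (x' - (y : E3 R)) in b0 *.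
  have ba : `|b - a| <= enorm (x - x').
    have t1 := enorm_triangle x x' (y : E3 R).
    have t2 := enorm_triangle x' x (y : E3 R).
    rewrite (enorm_distC x' x) in t2.
    by rewrite ler_norml; apply/andP; split; move: t1 t2; rewrite -/a -/b; lra.
  have -> : A y / a - A y / b = A y * ((b - a) * (a^-1 * b^-1)) by field; rewrite !gt_eqF.
  rewrite normrM (ger0_norm (A_ge0 _)) normrM (ger0_norm (_ : 0 <= a^-1 * b^-1)); last first.
    by rewrite mulr_ge0// invr_ge0 ltW.
  apply: (@le_trans _ _ (M * (enorm (x - x') * (a^-1 * b^-1)))).
    by rewrite ler_pM// ?ler_wpM2r// ?mulr_ge0// ?invr_ge0 ?(ltW a0) ?(ltW b0).
  rewrite -subr_ge0 [leRHS](_ : _ = k * (a^-1 - b^-1) ^+ 2); last first.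
    by rewrite /k; field; rewrite !gt_eqF.
  by rewrite mulr_ge0 ?sqr_ge0 ?ltW.
- rewrite ge0_integralD//; last 2 first.
  + by move=> y _; rewrite mule_ge0 ?lee_fin ?(ltW k0)//; exact: inv_sqr_majorant_ge0.
  + by move=> y _; rewrite mule_ge0 ?lee_fin ?(ltW k0)//; exact: inv_sqr_majorant_ge0.
  apply: (le_trans (leeD (integral_majorant_le x (ltW k0)) (integral_majorant_le x' (ltW k0)))).
  by rewrite -EFinD lee_fin /k le_eqVlt; apply/orP; left; apply/eqP; field.
Qed.

End PotentialEstimates.

(** * Riemann sums *)

Section Boxes.
Variables (R : realType) (D : R) (n : nat).
Hypothesis D_gt0 : 0 < D.
Hypothesis n_gt0 : (0 < n)%N.
Notation M3 := (measurableTypeR R * measurableTypeR R * measurableTypeR R)%type.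
Notation N := (n%:R : R).

Let N_gt0 : 0 < N. Proof. by rewrite ltr0n. Qed.
Let DN_gt0 : 0 < D / N. Proof. by rewrite divr_gt0. Qed.

Definition cell_lo (j : 'I_n.*2) : R := (j%:R - N) / N * D.

Definition cell (i : box n) : set M3 :=
  `[cell_lo i.1.1, cell_lo i.1.1 + D / N[ `*`
  `[cell_lo i.1.2, cell_lo i.1.2 + D / N[ `*`
  `[cell_lo i.2, cell_lo i.2 + D / N[.

Lemma measurable_cell (i : box n) : measurable (cell i).
Proof. by apply: measurableX => //; exact: measurableX. Qed.

Lemma lebesgue3_cell i : lebesgue3 R (cell i) = ((D / N) ^+ 3)%:E.
Proof.
rewrite /cell lebesgue3_box ?lerDl ?ltW//; congr EFin.
by ring.
Qed.

Lemma center_coordE (j : 'I_n.*2) : center_coord D j = cell_lo j + D / N / 2.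
Proof. by rewrite /center_coord /cell_lo; field; rewrite gt_eqF. Qed.

Lemma cell_lo_bound (j : 'I_n.*2) : - D <= cell_lo j /\ cell_lo j + D / N <= D.
Proof.
have j2 : (j%:R : R) + 1 <= 2 * N.
  by rewrite natr1 -natrM ler_nat mul2n.
have j0 : 0 <= j%:R :> R by [].
have -> : cell_lo j = j%:R * (D / N) - D by rewrite /cell_lo; field; rewrite gt_eqF.
have e : N * (D / N) = D by field; rewrite gt_eqF.
split; first by rewrite lerDr mulr_ge0// ltW.
have := ler_wpM2r (ltW DN_gt0) j2; rewrite mulrDl mul1r -mulrA e; lra.
Qed.

Lemma cell_sub i : cell i `<=` half_open_cube D.
Proof.
have [a1 b1] := cell_lo_bound i.1.1.
have [a2 b2] := cell_lo_bound i.1.2.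
have [a3 b3] := cell_lo_bound i.2.
have le_lt (j : 'I_n.*2) t : cell_lo j + D / N <= D -> - D <= cell_lo j ->
    t \in `[cell_lo j, cell_lo j + D / N[ -> t \in `[- D, D[.
  rewrite !in_itv/= => h1 h2 /andP[h3 h4].
  by rewrite (le_trans h2 h3) (lt_le_trans h4 h1).
move=> y [[/= h1 h2] h3]; split; [split|] => /=.
- exact: le_lt b1 a1 h1.
- exact: le_lt b2 a2 h2.
- exact: le_lt b3 a3 h3.
Qed.

Lemma cell_coord_ex (t : R) : t \in `[- D, D[ ->
  exists j : 'I_n.*2, t \in `[cell_lo j, cell_lo j + D / N[.
Proof.
rewrite in_itv/= => /andP[t1 t2].
have s0 : 0 <= (t + D) / (D / N) by rewrite divr_ge0 ?(ltW DN_gt0)//; lra.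
have s2 : (t + D) / (D / N) < n.*2%:R.
  rewrite ltr_pdivrMr// -mul2n natrM -mulrA (_ : N * (D / N) = D); first by lra.
  by field; rewrite gt_eqF.
have /andP[h1 h2] := truncn_itv s0.
have jlt : (Num.truncn ((t + D) / (D / N)) < n.*2)%N.
  by rewrite -(ltr_nat R) (le_lt_trans h1).
exists (Ordinal jlt).
have -> : cell_lo (Ordinal jlt) = (Num.truncn ((t + D) / (D / N)))%:R * (D / N) - D.
  by rewrite /cell_lo/=; field; rewrite gt_eqF.
rewrite in_itv/=; move: h1 h2; rewrite ler_pdivlMr// ltr_pdivrMr// -natr1.
by move=> ? ?; apply/andP; split; lra.
Qed.

Lemma cell_ex (y : M3) : half_open_cube D y -> exists i, cell i y.
Proof.
move=> [[/= /cell_coord_ex[j1 h1] /cell_coord_ex[j2 h2]] /cell_coord_ex[j3 h3]].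
by exists (j1, j2, j3).
Qed.

Lemma cell_lo_dist (j k : 'I_n.*2) : j != k -> D / N <= `|cell_lo j - cell_lo k|.
Proof.
move=> jk.
have -> : cell_lo j - cell_lo k = (j%:R - k%:R) * (D / N).
  by rewrite /cell_lo; field; rewrite gt_eqF.
rewrite normrM (ger0_norm (ltW DN_gt0)) ler_peMl ?(ltW DN_gt0)//.
have [jk'|kj|e] := ltngtP j k; last by move: jk; rewrite (ord_inj e) eqxx.
- by rewrite distrC -natrB ?(ltnW jk')// normr_nat ler1n subn_gt0.
- by rewrite -natrB ?(ltnW kj)// normr_nat ler1n subn_gt0.
Qed.

Lemma cell_uniq (y : M3) i j : cell i y -> cell j y -> i = j.
Proof.
have H (t : R) k l : t \in `[cell_lo k, cell_lo k + D / N[ ->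
    t \in `[cell_lo l, cell_lo l + D / N[ -> k = l.
  rewrite !in_itv/= => /andP[? ?] /andP[? ?]; apply/eqP; apply: contraT => /cell_lo_dist.
  by rewrite leNgt ltr_norml; case/negP; apply/andP; split; lra.
move=> [[/= a1 a2] a3] [[/= b1 b2] b3].
case: i j a1 a2 a3 b1 b2 b3 => -[i1 i2] i3 [[j1 j2] j3]/= a1 a2 a3 b1 b2 b3.
by rewrite (H _ _ _ a1 b1) (H _ _ _ a2 b2) (H _ _ _ a3 b3).
Qed.

(** Half the diagonal of a cell is (sqrt 3 / 2) * D / N, which is rounded up. *)
Lemma cell_center_dist (y : M3) i : cell i y -> enorm ((y : E3 R) - box_center D i) <= D / N.
Proof.
have H (t : R) k : t \in `[cell_lo k, cell_lo k + D / N[ -> `|t - center_coord D k| <= D / N / 2.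
  rewrite in_itv/= center_coordE => /andP[? ?]; rewrite ler_norml; apply/andP; split; lra.
move=> [[/= /H a1 /H a2] /H a3].
apply: (le_trans (@enorm_le_coord _ ((y : E3 R) - box_center D i) _ a1 a2 a3)).
rewrite mulrA mulrAC ler_piMl ?(ltW DN_gt0)// ler_pdivrMr// mul1r.
rewrite -[leRHS]ger0_norm// -sqrtr_sqr ler_sqrt; lra.
Qed.

Lemma box_center_dist (i j : box n) : i != j ->
  D / N <= enorm (box_center D i - box_center D j).
Proof.
move=> ij; have [h1 h2 h3] := enorm_ge_coord (box_center D i - box_center D j).
have E k l : center_coord D k - center_coord D l = cell_lo k - cell_lo l.
  by rewrite !center_coordE; ring.
have [e1|/cell_lo_dist n1] := eqVneq i.1.1 j.1.1; last first.
  by rewrite (le_trans n1)// (le_trans _ h1)//= E.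
have [e2|/cell_lo_dist n2] := eqVneq i.1.2 j.1.2; last first.
  by rewrite (le_trans n2)// (le_trans _ h2)//= E.
have [e3|/cell_lo_dist n3] := eqVneq i.2 j.2; last first.
  by rewrite (le_trans n3)// (le_trans _ h3)//= E.
case/eqP: ij; case: i j e1 e2 e3 {h1 h2 h3} => -[i1 i2] i3 [[j1 j2] j3]/=.
by move=> -> -> ->.
Qed.

Lemma center_coord_le (j : 'I_n.*2) : `|center_coord D j| <= D.
Proof.
have [? ?] := cell_lo_bound j; have := DN_gt0; rewrite center_coordE => ?.
by rewrite ler_norml; apply/andP; split; lra.
Qed.

Lemma box_center_cube (i : box n) : cube D (box_center D i).
Proof. by split; exact: center_coord_le. Qed.

Lemma enorm_box_center (i : box n) : enorm (box_center D i) <= Num.sqrt 3 * D.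
Proof. by apply: enorm_le_coord; exact: center_coord_le. Qed.

End Boxes.

(** * Comparison of a sum of point masses with the Newtonian potential *)

Section RiemannSum.
Variables (R : realType) (D : R) (A : E3 R -> R) (M : R) (n : nat).
Hypothesis D_gt0 : 0 < D.
Hypothesis n_gt0 : (0 < n)%N.
Hypothesis cA : continuous A.
Hypothesis A_supp : supported_in (cube D) A.
Hypothesis A_ge0 : forall y, 0 <= A y.
Hypothesis M_gt0 : 0 < M.
Hypothesis A_le : forall y, A y <= M.
Variables (m : box n -> R) (c omega L : R) (x : E3 R).
Notation M3 := (measurableTypeR R * measurableTypeR R * measurableTypeR R)%type.
Notation mu := (lebesgue3 R).
Notation Q := (half_open_cube D).
Notation N := (n%:R : R).
Notation p i := (box_center D i : E3 R).
Hypothesis m_ge0 : forall i, 0 <= m i.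
Hypothesis c_ge0 : 0 <= c.
Hypothesis mA : forall i, `|m i * (N / D) ^+ 3 - A (p i)| <= c.
Hypothesis omega_ge0 : 0 <= omega.
Hypothesis A_osc : forall (i : box n) y, enorm (y - p i) <= D / N -> `|A y - A (p i)| <= omega.
Hypothesis L_gt0 : 0 < L.
Hypothesis xL : enorm x <= L.
Hypothesis x_off : forall i, m i != 0 -> D / N ^+ 2 <= enorm (x - p i).

Let N_gt0 : 0 < N. Proof. by rewrite ltr0n. Qed.
Let DN_gt0 : 0 < D / N. Proof. by rewrite divr_gt0. Qed.
Let mQ : measurable Q := measurable_half_open_cube D.

(** The mass of a box divided by its volume, to be compared with the values of [A]. *)
Let a i := m i * (N / D) ^+ 3.
Let a_ge0 i : 0 <= a i.
Proof. by rewrite mulr_ge0// exprn_ge0// divr_ge0// ltW. Qed.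
Let a_le i : a i <= M + c.
Proof. by have := mA i; have := A_le (p i); rewrite ler_norml -/(a i) => ? /andP[? ?]; lra. Qed.

(** Centers are at least [D / N] apart, so at most one box fails to be far; it is estimated on its
    own through [x_off]. *)
Let far (i : box n) := D / N / 2 <= enorm (x - p i).
Let coef i := if far i then a i / enorm (x - p i) else 0.
Let coef_ge0 i : 0 <= coef i.
Proof. by rewrite /coef; case: ifP => // _; rewrite divr_ge0// enorm_ge0. Qed.
(** Constant on each cell, with integral over a cell equal to the potential of the point mass there.
    This turns the sum over the far boxes into an integral that can be compared pointwise with the
    Newtonian one. *)
Let step (y : M3) := \sum_(i : box n) coef i * \1_(cell D i) y.

Let stepE i (y : M3) : cell D i y -> step y = coef i.
Proof.
move=> iy; rewrite /step (bigD1 i)//= indicE mem_set// mulr1 big1 ?addr0// => j ji.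
rewrite indicE memNset ?mulr0// => jy.
by move: ji; rewrite (cell_uniq D_gt0 n_gt0 iy jy) eqxx.
Qed.

Let step_term_measurable i : measurable_fun Q (fun y : M3 => coef i * \1_(cell D i) y : R).
Proof. by apply: measurable_funM => //; apply: measurable_indic; exact: measurable_cell. Qed.

Let step_measurable : measurable_fun Q step.
Proof. by apply: measurable_sum => i; exact: step_term_measurable. Qed.

Let step_integral :
  (\int[mu]_(y in Q) (step y)%:E = (\sum_(i | far i) m i / enorm (x - p i))%:E)%E.
Proof.
under eq_integral do rewrite /step -sumEFin.
rewrite ge0_integral_sum//; last 2 first.
- by move=> i; exact/measurable_EFinP.
- by move=> i y _; rewrite lee_fin mulr_ge0.
rewrite -sumEFin [RHS]big_mkcond/=; apply: eq_bigr => i _.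
under eq_integral do rewrite EFinM.
have mI : measurable_fun Q (fun y : M3 => (\1_(cell D i) y : R)%:E).
  by apply/measurable_EFinP; apply: measurable_indic; exact: measurable_cell.
rewrite (ge0_integralZl _ mQ mI) ?lee_fin//.
rewrite integral_indic//; last exact: measurable_cell.
rewrite (setIidl (cell_sub D_gt0 n_gt0 (i := i))) lebesgue3_cell// -EFinM /coef.
case: ifP => _; last by rewrite mul0r.
have ND : (N / D) ^+ 3 * (D / N) ^+ 3 = 1 by field; rewrite !gt_eqF.
congr EFin; transitivity (m i / enorm (x - p i) * ((N / D) ^+ 3 * (D / N) ^+ 3)).
  by rewrite /a mulrA (mulrAC (m i)).
by rewrite ND mulr1.
Qed.

Let step_integrable : mu.-integrable Q (EFin \o step).
Proof.
apply/integrableP; split; first exact/measurable_EFinP.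
have -> : (\int[mu]_(y in Q) `|(EFin \o step) y| = \int[mu]_(y in Q) (step y)%:E)%E.
  apply: eq_integral => y _ /=; rewrite ger0_norm// /step sumr_ge0// => i _.
  by rewrite mulr_ge0.
by rewrite step_integral ltry.
Qed.

(** The first term is the error in the density ([c] from the parameters, [omega] from the
    oscillation of [A] over a cell), the second the effect of moving the pole from [y] to the center
    of its cell. *)
Definition riemann_kappa := (c + omega) * (L + 2 * D) + 3 * (M + c) * (D / N).

Let kappa_gt0 : 0 < riemann_kappa.
Proof.
have h1 : 0 <= (c + omega) * (L + 2 * D).
  by rewrite mulr_ge0// ?addr_ge0// ?mulr_ge0 ?ltW.
by rewrite ltr_wpDl// mulr_gt0// mulr_gt0// ltr_pwDl.
Qed.

Let pointwise (y : M3) : Q y ->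
  (`|step y - A y / enorm (x - (y : E3 R))|%:E <=
    riemann_kappa%:E * inv_sqr_majorant x y)%E.
Proof.
move=> Qy; have [i iy] := cell_ex D_gt0 n_gt0 Qy.
apply: inv_sqr_majorant_ge => // xy; rewrite (stepE iy).
have yp := cell_center_dist D_gt0 n_gt0 iy.
have e0 : 0 < enorm (x - (y : E3 R)).
  rewrite lt_neqAle enorm_ge0 andbT; apply: contra xy => /eqP/esym/enorm_eq0/eqP.
  by rewrite subr_eq0.
have inv_le := newton_le D_gt0 L_gt0 xL Qy xy.
set e := enorm (x - (y : E3 R)) in e0 inv_le *.
have ei : 0 < e^-1 by rewrite invr_gt0.
have t1 := enorm_triangle x (y : E3 R) (p i).
have t2 := enorm_triangle x (p i) (y : E3 R).
rewrite (enorm_distC (p i)) in t2.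
rewrite -/e in t1 t2; have am := a_le i.
rewrite /riemann_kappa mulrDl /coef; case: ifPn => [far_i|near_i].
  set q := enorm (x - p i) in t1 t2 far_i *; rewrite /far -/q in far_i.
  have q0 : 0 < q by apply: lt_le_trans far_i; rewrite divr_gt0.
  (* Separates the error in the density, at fixed pole, from the displacement of the pole. *)
  have -> : a i / q - A y / e = (a i - A y) / e + a i * (e - q) * (q^-1 * e^-1).
    by field; rewrite !gt_eqF.
  apply: (le_trans (ler_normD _ _)); apply: lerD.
    rewrite normrM (ger0_norm (ltW ei)).
    apply: (@le_trans _ _ ((c + omega) * e^-1)).
      rewrite ler_wpM2r ?(ltW ei)// (le_trans (ler_distD (A (p i)) _ _))// lerD//.
        exact: mA.
      by rewrite distrC; exact: A_osc.
    by rewrite -mulrA ler_wpM2l// addr_ge0.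
  (* For a far box [e <= q + D / N] and [D / N <= 2 * q], hence [e <= 3 * q]. *)
  have qi : q^-1 <= 3 * e^-1.
    by rewrite -[3]invrK -invfM lef_pV2 ?posrE ?mulr_gt0 ?invr_gt0//; lra.
  rewrite normrM (ger0_norm (_ : 0 <= q^-1 * e^-1)); last first.
    by rewrite mulr_ge0 ?invr_ge0 ?ltW.
  rewrite normrM (ger0_norm (a_ge0 i)).
  have eq : `|e - q| <= D / N by rewrite ler_norml; apply/andP; split; lra.
  have -> : 3 * (M + c) * (D / N) * e ^- 2 = (M + c) * (D / N) * (3 * e^-1 * e^-1).
    by field; rewrite !gt_eqF.
  have P1 : a i * `|e - q| <= (M + c) * (D / N) by apply: ler_pM.
  have P2 : q^-1 * e^-1 <= 3 * e^-1 * e^-1 by rewrite ler_wpM2r// ltW.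
  apply: ler_pM => //; first by rewrite mulr_ge0.
  by rewrite mulr_ge0 ?invr_ge0 ?(ltW q0) ?(ltW e0).
(* In the near cell [step] vanishes and the Newtonian integrand itself is the error. There [e] is
   below 3/2 * D / N, so 1/e is at most 3 * (D / N) * e^-2. *)
rewrite sub0r normrN ger0_norm ?mulr_ge0 ?(ltW ei)//.
rewrite /far -ltNge in near_i.
have h0 : 0 <= (c + omega) * (L + 2 * D) * e ^- 2.
  by rewrite !mulr_ge0 ?addr_ge0 ?mulr_ge0 ?invr_ge0 ?exprn_ge0 ?(ltW e0) ?(ltW L_gt0) ?(ltW D_gt0).
rewrite ler_wpDl//.
have -> : 3 * (M + c) * (D / N) * e ^- 2 = (M + c) * (3 * (D / N)) / e / e.
  by field; rewrite !gt_eqF.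
rewrite ler_wpM2r ?(ltW ei)// ler_pdivlMr//.
apply: ler_pM => //; first exact: ltW.
- by have := A_le y; have := c_ge0; lra.
- by move: near_i t1 (DN_gt0); lra.
Qed.

(** The far boxes are handled by integrating [pointwise]. The single near box has mass at most (M +
    c) * (D / N)^3 and a center no closer than D / N^2 if its mass is nonzero, which gives the last
    term. *)
Lemma riemann_sum_dist : `|sum_factor D m x - limit_factor A x| <=
  riemann_kappa * kernel_bound D + (M + c) * (D ^+ 2 / N).
Proof.
have near_sum : `|\sum_(i | ~~ far i) m i / enorm (x - p i)| <= (M + c) * (D ^+ 2 / N).
  have term_le i : ~~ far i -> m i / enorm (x - p i) <= (M + c) * (D ^+ 2 / N).
    move=> _; have [->|mi] := eqVneq (m i) 0.
      by rewrite mul0r mulr_ge0 ?addr_ge0 ?(ltW M_gt0)// divr_ge0// exprn_ge0// ltW.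
    have h := x_off mi; have d0 : 0 < D / N ^+ 2 by rewrite divr_gt0// exprn_gt0.
    rewrite ler_pdivrMr ?(lt_le_trans d0)//.
    apply: (@le_trans _ _ ((M + c) * (D ^+ 2 / N) * (D / N ^+ 2))); last first.
      rewrite ler_wpM2l// mulr_ge0 ?addr_ge0 ?(ltW M_gt0)// divr_ge0// exprn_ge0// ltW//.
    have -> : (M + c) * (D ^+ 2 / N) * (D / N ^+ 2) = (M + c) * (D / N) ^+ 3.
      by field; rewrite !gt_eqF.
    rewrite -ler_pdivrMr ?exprn_gt0// -exprVn invf_div; exact: a_le.
  rewrite ger0_norm; last by rewrite sumr_ge0// => i _; rewrite divr_ge0// enorm_ge0.
  have [/existsP[i0 i0P]|/existsPn none] := boolP [exists i, ~~ far i]; last first.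
    rewrite big_pred0; last by move=> i; apply/negbTE; exact: none.
    by rewrite mulr_ge0 ?addr_ge0 ?(ltW M_gt0)// divr_ge0// exprn_ge0// ltW.
  (* Two distinct near centers would be less than [D / N] apart. *)
  rewrite (big_pred1 i0) ?term_le// => i; apply/idP/eqP => [iP|-> //].
  apply/eqP; apply: contraT => /(box_center_dist D_gt0 n_gt0) h; exfalso; move: h.
  have := enorm_triangle (p i) x (p i0); rewrite (enorm_distC (p i) x).
  by move: iP i0P; rewrite /far -!ltNge; lra.
have -> : sum_factor D m x - limit_factor A x =
  (\int[mu]_(y in Q) step y - \int[mu]_(y in Q) (A y / enorm (x - (y : E3 R)))) +
  \sum_(i | ~~ far i) m i / enorm (x - p i).
  have -> : \int[mu]_(y in Q) step y = \sum_(i | far i) m i / enorm (x - p i).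
    by rewrite /Rintegral step_integral.
  rewrite (limit_factorE D_gt0 cA A_supp) /sum_factor (bigID far)/=.
  by ring.
apply: (le_trans (ler_normD _ _)); apply: lerD near_sum.
apply: (@Rintegral_dist_le _ _ _ _ (fun y => riemann_kappa%:E * inv_sqr_majorant x y)%E) => //.
- exact: (integrable_newton D_gt0 cA A_ge0 M_gt0).
- apply: measurable_funeM; exact: measurable_funS (measurable_inv_sqr_majorant x).
- by apply: integral_majorant_le => //; exact: ltW.
Qed.

End RiemannSum.

(** Dividing a mass by the volume (D / n)^3 of its box turns the error n^-4 of the masses into an
    error 1/n of the densities. *)
Lemma riemann_parameters_bound (R : realType) (D : R) (A : E3 R -> R)
    (alpha : forall n, box n -> R) : 0 < D -> riemann_parameters D A alpha ->
  exists2 C, 0 <= C & forall n (i : box n), (0 < n)%N ->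
    `|alpha n i * (n%:R / D) ^+ 3 - A (box_center D i)| <= C / n%:R.
Proof.
move=> D0 [_]; set S := ereal_sup _ => Soo.
have [C SC] : exists C : R, (S <= C%:E)%E.
  by case: S Soo => // [s _|_]; [exists s|exists 0; rewrite leNye].
exists (`|C| / D ^+ 3); first by rewrite divr_ge0// exprn_ge0// ltW.
move=> n i n0; have N0 : (0 : R) < n%:R by rewrite ltr0n.
have : ((n%:R ^+ 4 * `|alpha n i - A (box_center D i) * (D / n%:R) ^+ 3|)%:E <= C%:E)%E.
  by apply: le_trans SC; apply: ereal_sup_ubound; exists n, i.
rewrite lee_fin => h.
have -> : alpha n i * (n%:R / D) ^+ 3 - A (box_center D i) =
    (alpha n i - A (box_center D i) * (D / n%:R) ^+ 3) * (n%:R / D) ^+ 3.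
  by field; rewrite !gt_eqF.
rewrite normrM (ger0_norm (_ : 0 <= (n%:R / D) ^+ 3)); last first.
  by rewrite exprn_ge0// divr_ge0 ?ltW.
have -> : `|C| / D ^+ 3 / n%:R = `|C| / n%:R ^+ 4 * (n%:R / D) ^+ 3.
  by field; rewrite !gt_eqF.
rewrite ler_wpM2r ?exprn_ge0 ?divr_ge0 ?(ltW D0)//.
by rewrite ler_pdivlMr ?exprn_gt0// mulrC (le_trans h)// ler_norm.
Qed.

Lemma sum_factor_cvg (R : realType) (D : R) (A : E3 R -> R)
    (alpha : forall n, box n -> R) (L eta : R) : 0 < D -> continuous A ->
  (forall y, 0 <= A y) -> supported_in (cube D) A ->
  riemann_parameters D A alpha -> 0 < L -> 0 < eta ->
  \forall n \near \oo, forall x : E3 R, enorm x <= L ->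
    (forall i, alpha n i != 0 -> D / n%:R ^+ 2 <= enorm (x - box_center D i)) ->
    `|sum_factor D (alpha n) x - limit_factor A x| <= eta.
Proof.
move=> D0 cA A0 Asupp alphaP L0 eta0.
have [M M0 AM] := bounded_density cA Asupp.
have [C C0 HC] := riemann_parameters_bound D0 alphaP.
have K0 := kernel_bound_gt0 D0; set K := kernel_bound D in K0.
have LD : 0 < L + 2 * D by rewrite addr_gt0// mulr_gt0.
(* Makes the oscillation part of the error exactly [eta / 2]. All other parts are gathered in
   [E / n], after some occurrences of [C / n] have been enlarged to [C]. *)
pose omega := eta / 2 / ((L + 2 * D) * K).
have omega0 : 0 < omega by rewrite /omega !divr_gt0// mulr_gt0.
have [delta delta0 Hdelta] := unif_continuous_density D cA omega0.
pose E := (C * (L + 2 * D) + 3 * (M + C) * D) * K + (M + C) * D ^+ 2.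
have E0 : 0 <= E.
  have [M0' D0' K0' L0'] : [/\ 0 <= M, 0 <= D, 0 <= K & 0 <= L] by split; exact: ltW.
  by rewrite /E !(addr_ge0, mulr_ge0, exprn_ge0).
near=> n => x xL x_off.
have n0 : (0 < n)%N by near: n; exact: nbhs_infty_gt.
have N0 : (0 : R) < n%:R by rewrite ltr0n.
have En : 2 * E / eta <= n%:R by near: n; exact: nbhs_infty_ger.
have Dn : 2 * D / delta <= n%:R by near: n; exact: nbhs_infty_ger.
have cn : 0 <= C / n%:R by rewrite divr_ge0// ltW.
have A_osc (i : box n) y : enorm (y - box_center D i) <= D / n%:R ->
    `|A y - A (box_center D i)| <= omega.
  move=> h; apply: Hdelta; first exact: box_center_cube.
  apply: (le_lt_trans h); rewrite ltr_pdivrMr//.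
  by move: Dn; rewrite ler_pdivrMr//; lra.
have [alpha0 _] := alphaP.
have := @riemann_sum_dist _ D A M n D0 n0 cA Asupp A0 M0 AM (alpha n) (C / n%:R) omega L x
  (alpha0 n) cn (fun i => HC n i n0) (ltW omega0) A_osc L0 xL x_off.
move/le_trans; apply; rewrite -/K /riemann_kappa.
have n1 : 1 <= n%:R :> R by rewrite ler1n.
have cC : C / n%:R <= C by rewrite ler_pdivrMr// ler_peMr.
apply: (@le_trans _ _ (omega * (L + 2 * D) * K + E / n%:R)).
  rewrite -subr_ge0 [leRHS](_ : _ = (C - C / n%:R) * (3 * D * K + D ^+ 2) / n%:R); last first.
    by rewrite /E; field; rewrite gt_eqF.
  rewrite !mulr_ge0 ?subr_ge0 ?invr_ge0 ?(ltW N0)//.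
  by rewrite addr_ge0 ?exprn_ge0 ?mulr_ge0 ?(ltW D0) ?(ltW K0).
have -> : omega * (L + 2 * D) * K = eta / 2.
  by rewrite /omega; field; rewrite !gt_eqF.
suff : E / n%:R <= eta / 2 by lra.
rewrite ler_pdivrMr//; move: En; rewrite ler_pdivrMr//; lra.
Unshelve. all: by end_near. Qed.

(** * Rerouting paths around the holes *)

(** A path in [U] competes also in the infimum over [B], and its two lengths compare pointwise
    through [F <= c * f]. *)
Lemma path_dist_mono (R : realType) (U B : set (E3 R)) (f F : E3 R -> R) (c : R) x y :
  U `<=` B -> (forall z, U z -> {for z, continuous f}) -> (forall z, U z -> 1 <= f z) ->
  (forall z, B z -> {for z, continuous F}) -> (forall z, B z -> 1 <= F z) ->
  0 < c -> (forall z, U z -> F z <= c * f z) ->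
  (path_dist B (conformal F) x y <= c%:E * path_dist U (conformal f) x y)%E.
Proof.
move=> UB fc f1 Fc F1 c0 Ff.
rewrite -lee_pdivrMl//; apply: le_ereal_inf_tmp => _ [a [b [g [[ab pab] gU [<- <-] ->]]]].
rewrite lee_pdivrMl// (path_lengthE f1)//.
have gB : {in `[a, b], forall t, B (g t)} by move=> t /gU/UB.
apply: (le_trans (path_dist_le F1 ab pab gB)).
have mf := dens_measurable fc ab pab gU.
have mF := dens_measurable Fc ab pab gB.
rewrite -ge0_integralZl//; last 3 first.
- exact/measurable_EFinP.
- by move=> t /gU/(dens_ge0 f1); rewrite lee_fin.
- by rewrite lee_fin ltW.
apply: ge0_le_integral => //.
- by move=> t /gB/(dens_ge0 F1); rewrite lee_fin.
- exact/measurable_EFinP.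
- by apply: measurable_funeM; exact/measurable_EFinP.
- move=> t /gU/Ff h; rewrite -EFinM lee_fin mulrA ler_wpM2r//; exact: enorm_ge0.
Qed.

Section Perforated.
Variables (R : realType) (I : finType) (S : pred I) (p : I -> E3 R) (h r rho : R).
Hypothesis r_gt0 : 0 < r.
Hypothesis rh : 64 * r <= h.
Hypothesis p_dist : forall i j, i != j -> h <= enorm (p i - p j).
Hypothesis p_in : forall i, enorm (p i) + h <= rho.

Definition perforated : set (E3 R) :=
  eball 0 rho `\` \bigcup_(i in [set i | S i]) eball (p i) r.
Local Notation U := perforated.
Local Notation B := (eball (0 : E3 R) rho).

Lemma eball0E (z : E3 R) : B z = (enorm z < rho) :> Prop.
Proof. by rewrite /eball/= subr0. Qed.

Lemma perforatedP z : U z <-> enorm z < rho /\ forall i, S i -> r <= enorm (z - p i).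
Proof.
split=> [[]|[zr zp]].
  rewrite eball0E => zr zp; split=> // i Si; rewrite leNgt; apply/negP => zi.
  by apply: zp; exists i.
split; first by rewrite eball0E.
by move=> [i /= Si]; rewrite /eball/= ltNge zp.
Qed.

Lemma perforated_sub : U `<=` B.
Proof. by move=> z []. Qed.

(** Within [h / 2] of one center, every other center is at least [h / 2] away, so only the hole
    around [p i] can contain the point. *)
Lemma near_center_perforated z i : enorm (z - p i) <= h / 2 ->
  (S i -> r <= enorm (z - p i)) -> U z.
Proof.
move=> zi Sr; apply/perforatedP; split.
  have := enormD (z - p i) (p i); rewrite subrK.
  have := p_in i; have := r_gt0; have := rh; lra.
move=> j Sj; have [ij|ji] := eqVneq i j; first by rewrite -ij; apply: Sr; rewrite ij.
have := p_dist ji; have := enorm_triangle (p i) z (p j).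
rewrite (enorm_distC (p i) z); have := r_gt0; have := rh; lra.
Qed.

Lemma eball_convex (u w : E3 R) t : 0 <= t <= 1 -> B u -> B w -> B (u + t *: (w - u)).
Proof.
move=> /andP[t0 t1]; rewrite !eball0E => uB wB.
have -> : u + t *: (w - u) = (1 - t) *: u + t *: w.
  by rewrite scalerBr scalerBl scale1r addrCA addrC addrAC -addrA.
apply: (le_lt_trans (enormD _ _)); rewrite !enormZ !ger0_norm ?subr_ge0//.
have [->|tn0] := eqVneq t 0; first by rewrite subr0 mul1r mul0r addr0.
have t_gt0 : 0 < t by rewrite lt_neqAle eq_sym tn0.
have h1 : (1 - t) * enorm u <= (1 - t) * rho by rewrite ler_wpM2l ?subr_ge0// ltW.
have h2 : t * enorm w < t * rho by rewrite ltr_pM2l.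
lra.
Qed.

(** All points of a hole are sent to one fixed point of its boundary sphere: this costs at most the
    diameter and, unlike a radial projection, makes sense at the center. *)
Lemma perforated_proj z : B z -> exists z', [/\ U z', enorm (z - z') <= 2 * r & U z -> z' = z].
Proof.
move=> Bz; have [Uz|nUz] := pselect (U z).
  by exists z; rewrite subrr enorm0; split => //; rewrite mulr_ge0// ltW.
have [i Si zi] : exists2 i, S i & enorm (z - p i) < r.
  apply: contrapT => H; apply: nUz; split => // -[i Si zi]; apply: H; by exists i.
pose e : E3 R := (r, 0, 0).
have er : enorm e = r.
  by rewrite /enorm /edot/= !mulr0 !addr0 -expr2 sqrtr_sqr ger0_norm// ltW.
exists (p i + e); split=> //.
- apply: (@near_center_perforated _ i); rewrite (addrC (p i)) addrK er//.
  by have := rh; have := r_gt0; lra.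
- rewrite opprD addrA (le_trans (enormD _ _))// enormN er; lra.
Qed.

Variable f : E3 R -> R.
Hypothesis fc : forall z, U z -> {for z, continuous f}.
Hypothesis f1 : forall z, U z -> 1 <= f z.
Local Notation d := (path_dist U (conformal f)).

Lemma segment_near (u w : E3 R) t : 0 <= t <= 1 ->
  enorm (u + t *: (w - u) - u) <= enorm (u - w).
Proof.
move=> /andP[t0 t1]; rewrite addrAC subrr add0r enormZ ger0_norm//.
by rewrite (enorm_distC u) ler_piMl// enorm_ge0.
Qed.

(* If the segment meets a hole, translate it by [r] in an orthogonal direction
   pointing away from the center of the hole. *)
Lemma path_dist_short (M : R) u w : U u -> U w -> enorm (u - w) <= h / 8 ->
  (forall z, U z -> enorm (z - u) <= h -> f z <= M) ->
  (d u w <= (M * (enorm (u - w) + 2 * r))%:E)%E.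
Proof.
move=> Uu Uw uw fM; have r0 := r_gt0; have rh' := rh.
have M0 : 0 <= M.
  by apply: le_trans (fM u Uu _); rewrite ?(le_trans _ (f1 Uu))// subrr enorm0; lra.
have [inU|] := pselect (forall t, 0 <= t <= 1 -> U (u + t *: (w - u))).
  apply: (@le_trans _ _ (M * enorm (u - w))%:E).
    apply: path_dist_segment => // t t01; split; first exact: inU.
    apply: fM; first exact: inU.
    by apply: (le_trans (segment_near u w t01)); lra.
  by rewrite lee_fin ler_wpM2l//; lra.
move=> notU.
have [t [i [t01 Si zi]]] : exists t i, [/\ 0 <= t <= 1, S i & enorm (u + t *: (w - u) - p i) < r].
  apply: contrapT => H; apply: notU => t t01; split.
    by apply: eball_convex => //; exact: perforated_sub.
  by move=> [i Si zi]; apply: H; exists t, i.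
have [e0 e01 e0uw] := unit_perp (u - w).
have [e [e1 euw eup]] : exists e : E3 R, [/\ enorm e = 1, edot e (u - w) = 0 & 0 <= edot e (u - p i)].
  have [h0|h0] := leP 0 (edot e0 (u - p i)); first by exists e0.
  exists (- e0); rewrite enormN !edotNl e0uw oppr0; split => //.
  by rewrite oppr_ge0 ltW.
have ewp : 0 <= edot e (w - p i).
  have -> : w - p i = (u - p i) - (u - w) by rewrite opprB [RHS]addrC addrA subrK.
  by rewrite edotDr edotNr euw subr0.
have ee : edot e e = 1 by rewrite -enorm2 e1 expr1n.
have up : enorm (u - p i) <= h / 8 + r.
  have := enorm_triangle u (u + t *: (w - u)) (p i).
  rewrite (enorm_distC u (u + _)); have := segment_near u w t01; lra.
have wp : enorm (w - p i) <= h / 4 + r.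
  by have := enorm_triangle w u (p i); rewrite (enorm_distC w u); lra.
have [_ /(_ _ Si) ur] := (perforatedP u).1 Uu.
have [_ /(_ _ Si) wr] := (perforatedP w).1 Uw.
(* Adding [s *: e] to q = v - p i changes |q|^2 by 2 * s * (e . q) + s^2, which is nonnegative. *)
have shift_far (v : E3 R) s : r <= enorm (v - p i) -> 0 <= edot e (v - p i) -> 0 <= s ->
    r <= enorm (v + s *: e - p i).
  move=> vr ev s0; apply: (le_trans vr).
  rewrite -(@ler_pXn2r _ 2)// ?nnegrE ?enorm_ge0// addrAC !enorm2.
  move: ev; move: (v - p i) => q ev; rewrite edotDl !edotDr !edotZl !edotZr ee (edotC _ e) mulr1.
  have : 0 <= s * edot e q by rewrite mulr_ge0.
  have : 0 <= s * s by rewrite mulr_ge0.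
  lra.
have good (z : E3 R) : enorm (z - u) <= h / 8 + r -> r <= enorm (z - p i) ->
    U z /\ f z <= M.
  move=> zu zr; have Uz : U z.
    apply: (@near_center_perforated _ i) => //.
    by have := enorm_triangle z u (p i); lra.
  by split => //; apply: fM => //; lra.
pose u' := u + r *: e; pose w' := w + r *: e.
have enormr (s : R) : 0 <= s -> enorm (s *: e) = s.
  by move=> s0; rewrite enormZ e1 mulr1 ger0_norm.
have uu' : enorm (u - u') = r by rewrite /u' opprD addrA subrr add0r enormN enormr// ltW.
have ww' : enorm (w' - w) = r by rewrite /w' addrAC subrr add0r enormr// ltW.
have u'w'E : w' - u' = w - u by rewrite /u' /w' opprD addrACA subrr addr0.
have d1 : (d u u' <= (M * r)%:E)%E.
  rewrite -[X in (M * X)%R]uu'; apply: path_dist_segment => // s /andP[s0 s1].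
  have -> : u + s *: (u' - u) = u + (s * r) *: e.
    by rewrite /u' addrAC subrr add0r scalerA.
  have sr : 0 <= s * r by rewrite mulr_ge0// ltW.
  apply: good; last exact: shift_far.
  by rewrite addrAC subrr add0r enormr//; have : s * r <= r by [rewrite ler_piMl// ltW]; lra.
have d2 : (d u' w' <= (M * enorm (u - w))%:E)%E.
  have -> : enorm (u - w) = enorm (u' - w') by rewrite enorm_distC -u'w'E enorm_distC.
  apply: path_dist_segment => // s s01; rewrite u'w'E.
  have -> : u' + s *: (w - u) = (u + s *: (w - u)) + r *: e by rewrite /u' addrAC.
  apply: good.
    rewrite addrAC; apply: (le_trans (enormD _ _)); rewrite enormr ?(ltW r0)//.
    by rewrite lerD2r; exact: le_trans (segment_near u w s01) uw.
  (* The translated chord clears the hole because its component along [e], measured from the center,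
     is at least [r]: the chord is orthogonal to [e] and starts on the nonnegative side. *)
  have : edot e (u + s *: (w - u) + r *: e - p i) <= enorm (u + s *: (w - u) + r *: e - p i).
    by apply: (le_trans (edot_le_enorm _ _)); rewrite e1 mul1r.
  apply: le_trans.
  have -> : u + s *: (w - u) + r *: e - p i = (u - p i) + (- s) *: (u - w) + r *: e.
    by rewrite scaleNr -scalerN opprB [LHS]addrAC (addrAC u).
  by rewrite 2!edotDr !edotZr euw mulr0 addr0 ee mulr1 lerDr.
have d3 : (d w' w <= (M * r)%:E)%E.
  rewrite (path_dist_sym fc f1) -[X in (M * X)%R]ww' enorm_distC; apply: path_dist_segment => // s /andP[s0 s1].
  have -> : w + s *: (w' - w) = w + (s * r) *: e.
    by rewrite /w' addrAC subrr add0r scalerA.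
  have sr : 0 <= s * r by rewrite mulr_ge0// ltW.
  apply: good; last exact: shift_far.
  rewrite addrAC (le_trans (enormD _ _))// enormr// (enorm_distC w).
  by have : s * r <= r by [rewrite ler_piMl// ltW]; lra.
apply: (le_trans (path_dist_triangle fc f1 u' u w)).
apply: (le_trans (leeD d1 (path_dist_triangle fc f1 w' u' w))).
apply: (le_trans (leeD (lexx _) (leeD d2 d3))).
by rewrite -!EFinD lee_fin; lra.
Qed.

End Perforated.

(** * Rerouting a whole path, piece by piece *)

Section Reroute.
Variables (R : realType) (I : finType) (S : pred I) (p : I -> E3 R) (h r rho : R).
Hypothesis r_gt0 : 0 < r.
Hypothesis rh : 64 * r <= h.
Hypothesis p_dist : forall i j, i != j -> h <= enorm (p i - p j).
Hypothesis p_in : forall i, enorm (p i) + h <= rho.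
Local Notation U := (perforated S p r rho).
Local Notation B := (eball (0 : E3 R) rho).
Notation mu := (@lebesgue_measure R).
Variables (f F : E3 R -> R) (eta M : R).
Hypothesis fc : forall z, U z -> {for z, continuous f}.
Hypothesis f1 : forall z, U z -> 1 <= f z.
Hypothesis Fc : forall z, B z -> {for z, continuous F}.
Hypothesis F1 : forall z, B z -> 1 <= F z.
Hypothesis eta_ge0 : 0 <= eta.
Hypothesis eta_le1 : eta <= 1.
Hypothesis FM : forall z, B z -> F z <= M.
Hypothesis fF : forall z, U z -> f z <= F z + eta.
Hypothesis F_osc : forall z z', B z -> B z' -> enorm (z - z') <= 2 * h -> `|F z - F z'| <= eta.
Local Notation d := (path_dist U (conformal f)).

Let delta := h / 16.
(** The overhead of one piece: 4r for moving its two ends out of holes and 2r for a sideways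
    translation, times the bound [M + 2] on the density. *)
Definition reroute_cost := 6 * r * (M + 2).
Let h_gt0 : 0 < h. Proof. by have := r_gt0; have := rh; lra. Qed.
Let delta_gt0 : 0 < delta. Proof. by rewrite divr_gt0. Qed.

Section Path.
Variables (a b : R) (gamma : R -> E3 R) (proj : E3 R -> E3 R).
Hypothesis ab : a < b.
Hypothesis pab : piecewise_smooth a b gamma.
Hypothesis gB : {in `[a, b], forall t, B (gamma t)}.
Hypothesis projP : forall z, B z ->
  [/\ U (proj z), enorm (z - proj z) <= 2 * r & U z -> proj z = z].

Let len s t := (\int[mu]_(u in `[s, t]) (F (gamma u) * enorm (derive1 gamma u))%:E)%E.
Let speed u := enorm (derive1 gamma u).

Let sub_measurable (g : R -> R) s t : a <= s -> t <= b ->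
  measurable_fun `[a, b] g -> measurable_fun `[s, t] g.
Proof.
by move=> as_ tb; apply: measurable_funS => //; apply: subset_itv; rewrite bnd_simp.
Qed.

Let in_ab s t u : a <= s -> t <= b -> u \in `[s, t] -> u \in `[a, b].
Proof.
rewrite !in_itv/= => as_ tb /andP[su ut].
by rewrite (le_trans as_ su) (le_trans ut tb).
Qed.

Let len_ge_speed s t : a <= s -> t <= b ->
  (\int[mu]_(u in `[s, t]) (speed u)%:E <= len s t)%E.
Proof.
move=> as_ tb; apply: ge0_le_integral => //.
- by move=> u _; rewrite lee_fin enorm_ge0.
- by apply/measurable_EFinP; apply: sub_measurable => //; exact: speed_measurable.
- by apply/measurable_EFinP; apply: sub_measurable => //; exact: (dens_measurable Fc ab pab gB).
- move=> u ust; rewrite lee_fin ler_peMl ?enorm_ge0//; apply: F1; apply: gB.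
  exact: in_ab ust.
Qed.

(** With [ell] the chord, the piece has length at least ell * (Fs - eta), while its replacement
    costs at most (Fs + 2 * eta) * (ell + 6 * r). The discrepancy 3 * eta * ell is absorbed in the
    length because [F] is at least 1. *)
Lemma reroute_piece s t : a <= s -> s <= t -> t <= b ->
  (\int[mu]_(u in `[s, t]) (speed u)%:E <= delta%:E)%E ->
  (d (proj (gamma s)) (proj (gamma t)) <=
    (1 + 3 * eta)%:E * len s t + reroute_cost%:E)%E.
Proof.
move=> as_ st tb sp; have r0 := r_gt0; have rh' := rh.
have close u : s <= u -> u <= t -> enorm (gamma u - gamma s) <= delta.
  move=> su ut; rewrite -lee_fin.
  apply: (le_trans (enorm_le_speed ab pab as_ su (le_trans ut tb))); apply: le_trans sp.
  apply: ge0_subset_integral => //.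
  - by apply/measurable_EFinP; apply: sub_measurable => //; exact: speed_measurable.
  - by move=> v _; rewrite lee_fin enorm_ge0.
  - by apply: subset_itv; rewrite bnd_simp.
have sab : s \in `[a, b] by rewrite in_itv/= as_ (le_trans st).
have tab : t \in `[a, b] by rewrite in_itv/= tb (le_trans as_).
have [Us us _] := projP (gB sab).
have [Ut ut _] := projP (gB tab).
set u := proj (gamma s) in Us us *; set w := proj (gamma t) in Ut ut *.
set ell := enorm (gamma t - gamma s).
have ell_le : ell <= delta by exact: close.
have ell_ge0 : 0 <= ell by exact: enorm_ge0.
have Fs1 := F1 (gB sab); have FsM := FM (gB sab); set Fs := F (gamma s) in Fs1 FsM *.
have uw : enorm (u - w) <= ell + 4 * r.
  have := enorm_triangle u (gamma s) w; have := enorm_triangle (gamma s) (gamma t) w.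
  by rewrite (enorm_distC u (gamma s)) (enorm_distC (gamma s) (gamma t)) -/ell; lra.
have short : (d u w <= ((Fs + 2 * eta) * (enorm (u - w) + 2 * r))%:E)%E.
  apply: (path_dist_short r_gt0 rh p_dist p_in fc f1) => //.
    (* Here the constant 64 is decided: h / 16 + 4 * r must not exceed h / 8. *)
    by move: uw ell_le; rewrite /delta; lra.
  move=> z Uz zu; apply: (le_trans (fF Uz)).
  have : `|F z - Fs| <= eta.
    apply: F_osc => //; [exact: perforated_sub Uz|exact: gB|].
    by have := enorm_triangle z u (gamma s); rewrite (enorm_distC u (gamma s)); lra.
  by rewrite ler_norml => /andP[_]; lra.
have len_ge : ((ell * (Fs - eta))%:E <= len s t)%E.
  apply: (@le_trans _ _ (\int[mu]_(v in `[s, t]) ((Fs - eta)%:E * (speed v)%:E))%E).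
    have Fs0 : 0 <= Fs - eta by have := eta_le1; lra.
    rewrite ge0_integralZl//; first last.
    - by move=> v _; rewrite lee_fin enorm_ge0.
    - by apply/measurable_EFinP; apply: sub_measurable => //; exact: speed_measurable.
    rewrite mulrC EFinM lee_wpmul2l ?lee_fin//.
    exact: (enorm_le_speed ab pab as_ st tb).
  apply: ge0_le_integral => //.
  - move=> v _; rewrite -EFinM lee_fin mulr_ge0 ?enorm_ge0//; by have := eta_le1; lra.
  - apply: measurable_funeM; apply/measurable_EFinP; apply: sub_measurable => //; exact: speed_measurable.
  - by apply/measurable_EFinP; apply: sub_measurable => //; exact: (dens_measurable Fc ab pab gB).
  - move=> v vst; rewrite -EFinM lee_fin ler_wpM2r ?enorm_ge0//.
    have Bv := gB (in_ab as_ tb vst).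
    have : `|F (gamma v) - Fs| <= eta.
      apply: F_osc => //; first exact: gB.
      move: vst; rewrite /= in_itv/= => /andP[v1 v2].
      by have := close v v1 v2; rewrite /delta; have := h_gt0; lra.
    by rewrite ler_norml => /andP[+ _]; lra.
have len_ge' : (ell%:E <= len s t)%E.
  exact: le_trans (enorm_le_speed ab pab as_ st tb) (len_ge_speed as_ tb).
have [->|lenoo] := eqVneq (len s t) +oo%E.
  have pos : 0 < 1 + 3 * eta by have := eta_ge0; lra.
  by rewrite gt0_muley ?lte_fin// addye// leey.
have lfin : len s t \is a fin_num.
  by rewrite fin_real// ltey lenoo andbT (lt_le_trans _ len_ge')// ltNyr.
rewrite -(fineK lfin) in len_ge len_ge' *.
set l := fine (len s t) in len_ge len_ge' *.
rewrite !lee_fin in len_ge len_ge'.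
apply: (le_trans short); rewrite -EFinM -EFinD lee_fin /reroute_cost.
apply: (@le_trans _ _ ((Fs + 2 * eta) * (ell + 6 * r))).
  by rewrite ler_wpM2l//; [have := eta_ge0; lra|lra].
have e1 : eta * ell <= eta * l by rewrite ler_wpM2l.
have e2 : r * (Fs + 2 * eta) <= r * (M + 2).
  by rewrite ler_wpM2l ?(ltW r0)//; have := eta_le1; lra.
move: len_ge e1 e2; rewrite !mulrDr !mulrDl !(mulrC ell) !(mulrC r); lra.
Qed.

(* Cut off an initial piece of Euclidean length exactly [h / 16]; as the density is at
   least 1, this uses up at least as much of the length. *)
Lemma reroute_steps k s : a <= s -> s <= b -> (len s b < (k%:R * delta)%:E)%E ->
  (d (proj (gamma s)) (proj (gamma b)) <=
    (1 + 3 * eta)%:E * len s b + (k%:R * reroute_cost)%:E)%E.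
Proof.
have c0 : 0 <= reroute_cost.
  rewrite /reroute_cost mulr_ge0//; first by have := r_gt0; lra.
  have Ba : B (gamma a) by apply: gB; rewrite in_itv/= lexx ltW.
  by have := FM Ba; have := F1 Ba; lra.
have len_ge0 v t : a <= v -> t <= b -> (0 <= len v t)%E.
  move=> av tb; apply: integral_ge0 => u uvt; apply: (dens_ge0 F1).
  by apply: gB; exact: in_ab uvt.
elim: k s => [|k ih] s as_ sb len_lt.
  by move: len_lt; rewrite mul0r ltNge len_ge0.
have [small|big] := leP (\int[mu]_(u in `[s, b]) (speed u)%:E)%E delta%:E.
  apply: (le_trans (reroute_piece as_ sb (lexx b) small)).
  by rewrite leeD2l// lee_fin -natr1 mulrDl mul1r lerDr mulr_ge0.
have mspeed : measurable_fun `[s, b] speed.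
  by apply: sub_measurable => //; exact: speed_measurable.
have speed_int : mu.-integrable `[s, b] (EFin \o speed).
  apply/integrableP; split; first exact/measurable_EFinP.
  rewrite (_ : (\int[mu]_(u in _) _ = \int[mu]_(u in `[s, b]) (speed u)%:E)%E); last first.
    by apply: eq_integral => u _ /=; rewrite ger0_norm// enorm_ge0.
  by apply: (le_lt_trans (len_ge_speed as_ (lexx b))); rewrite (lt_trans len_lt)// ltry.
have [t tsb t_delta] : exists2 t, t \in `[s, b] &
    \int[mu]_(u in `[s, t]) speed u = delta.
  apply: (@IVT _ (fun t => \int[mu]_(u in `[s, t]) speed u)) => //.
    exact: parameterized_integral_continuous.
  rewrite set_itv1 Rintegral_set1 minEle maxEle.
  have i0 : 0 <= \int[mu]_(u in `[s, b]) speed u.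
    by apply: Rintegral_ge0 => u _; exact: enorm_ge0.
  rewrite i0 (ltW delta_gt0)/= -lee_fin /Rintegral fineK ?ltW//.
  exact: integrable_fin_num speed_int.
move: tsb; rewrite in_itv/= => /andP[st tb].
have t_int : (\int[mu]_(u in `[s, t]) (speed u)%:E = delta%:E)%E.
  rewrite -t_delta /Rintegral fineK//; apply: integrable_fin_num => //.
  apply: integrableS speed_int => //; apply: subset_itv; by rewrite bnd_simp.
have splitE : len s b = (len s t + len t b)%E.
  apply: ge0_integral_itv_cat => //.
    by apply: sub_measurable => //; exact: (dens_measurable Fc ab pab gB).
  move=> u ust; apply: (dens_ge0 F1); apply: gB; exact: in_ab ust.
have at_ := le_trans as_ st.
have len_t : (len t b < (k%:R * delta)%:E)%E.
  rewrite ltNge; apply/negP => H; move: len_lt; rewrite ltNge => /negP; apply.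
  rewrite splitE -natr1 mulrDl mul1r addrC EFinD leeD//.
  by rewrite -t_int; exact: len_ge_speed.
apply: (le_trans (path_dist_triangle fc f1 (proj (gamma t)) _ _)).
apply: (le_trans (leeD (reroute_piece as_ st tb _) (ih t at_ tb len_t))).
  by rewrite t_int.
rewrite splitE; move: (len s t) (len t b) (len_ge0 s t as_ tb) (len_ge0 t b at_ (lexx b)).
move=> l1 l2 l1_ge0 l2_ge0; rewrite (ge0_muleDr _ l1_ge0 l2_ge0) addeACA leeD2l//.
by rewrite -EFinD lee_fin -natr1 mulrDl mul1r addrC.
Qed.

End Path.

(** A path of length below [lambda] is cut into at most lambda / (h / 16) + 1 pieces. Its ends are
    already in [U], so the projection leaves them fixed. *)
Lemma path_dist_reroute x y (lambda : R) : U x -> U y ->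
  (path_dist B (conformal F) x y < lambda%:E)%E ->
  (d x y <= ((1 + 3 * eta) * lambda +
    (lambda / (h / 16) + 1) * reroute_cost)%:E)%E.
Proof.
move=> Ux Uy /(path_dist_lt F1)[a [b [gamma [ab pab gB [ga gb] lenl]]]].
have [proj projP] : exists proj : E3 R -> E3 R, forall z, B z ->
  [/\ U (proj z), enorm (z - proj z) <= 2 * r & U z -> proj z = z].
  have : forall z : E3 R, exists z', B z ->
      [/\ U z', enorm (z - z') <= 2 * r & U z -> z' = z].
    move=> z; have [Bz|nB] := pselect (B z); last by exists z.
    by have [z' ?] := perforated_proj S r_gt0 rh p_dist p_in Bz; exists z'.
  by move=> /choice[proj H]; exists proj.
have BU := @perforated_sub R I S p r rho.
have c0 : 0 <= reroute_cost.
  rewrite /reroute_cost mulr_ge0//; first by have := r_gt0; lra.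
  by have := FM (BU _ Ux); have := F1 (BU _ Ux); lra.
have l0 : 0 <= lambda.
  rewrite -lee_fin; apply: le_trans (ltW lenl); apply: integral_ge0 => u uab.
  by apply: (dens_ge0 F1); exact: gB.
pose k := (Num.truncn (lambda / delta)).+1.
have ld0 : 0 <= lambda / delta by rewrite divr_ge0// ltW.
have /andP[k1 k2] := truncn_itv ld0.
have lk : (\int[mu]_(u in `[a, b]) (F (gamma u) * enorm (derive1 gamma u))%:E < (k%:R * delta)%:E)%E.
  by apply: (lt_trans lenl); rewrite lte_fin -ltr_pdivrMr.
have := reroute_steps ab pab gB projP (lexx a) (ltW ab) lk.
have [_ _ fix_x] := projP _ (BU _ Ux); have [_ _ fix_y] := projP _ (BU _ Uy).
rewrite ga gb fix_x// fix_y// => /le_trans; apply.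
apply: (@le_trans _ _ ((1 + 3 * eta)%:E * lambda%:E + (k%:R * reroute_cost)%:E)%E).
  rewrite leeD2r// lee_wpmul2l ?(ltW lenl)// lee_fin.
  by have := eta_ge0; lra.
rewrite -EFinM -EFinD lee_fin lerD2l ler_wpM2r// -/delta.
by rewrite /k -natr1 lerD2r.
Qed.

End Reroute.

(** * Convergence *)

(** Passes from extended-valued distances to the real-valued gluing lemma. Finiteness on [B] is
    assumed, and on [U] it follows from the comparison of the two distances. *)
Lemma GH_path_dist_le (R : realType) (U B : set (E3 R)) (f F : E3 R -> R) (e : R) :
  0 < e -> U `<=` B -> U !=set0 ->
  (forall z, U z -> {for z, continuous f}) -> (forall z, U z -> 1 <= f z) ->
  (forall z, B z -> {for z, continuous F}) -> (forall z, B z -> 1 <= F z) ->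
  (forall x y, B x -> B y -> (path_dist B (conformal F) x y < +oo)%E) ->
  (forall x y, U x -> U y ->
    (path_dist U (conformal f) x y <= path_dist B (conformal F) x y + e%:E)%E) ->
  (forall x y, U x -> U y ->
    (path_dist B (conformal F) x y <= path_dist U (conformal f) x y + e%:E)%E) ->
  (forall y, B y -> exists2 x, U x & (path_dist B (conformal F) x y <= e%:E)%E) ->
  (GH_dist U (path_dist U (conformal f)) B (path_dist B (conformal F)) <= (3 * e)%:E)%E.
Proof.
move=> e0 UB U0 fc f1 Fc F1 Boo UleB BleU dense.
have fin (V : set (E3 R)) (g : E3 R -> R) x y : (forall z, V z -> {for z, continuous g}) ->
    (forall z, V z -> 1 <= g z) -> (path_dist V (conformal g) x y < +oo)%E ->
    path_dist V (conformal g) x y = (fine (path_dist V (conformal g) x y))%:E.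
  move=> gc g1 h; rewrite fineK// fin_real// h andbT.
  by rewrite (lt_le_trans _ (path_dist_ge gc g1 x y))// ltNyr.
have refl (V : set (E3 R)) (g : E3 R -> R) x : (forall z, V z -> {for z, continuous g}) ->
    (forall z, V z -> 1 <= g z) -> V x -> path_dist V (conformal g) x x = 0%E.
  move=> gc g1 Vx; apply/eqP; rewrite eq_le; apply/andP; split; last first.
    by apply: le_trans (path_dist_ge gc g1 x x); rewrite subrr enorm0.
  have : (path_dist V (conformal g) x x <= (g x * enorm (x - x))%:E)%E.
    by apply: path_dist_segment => // t _; rewrite subrr scaler0 addr0.
  by rewrite subrr enorm0 mulr0.
have pos (V : set (E3 R)) (g : E3 R -> R) x y : (forall z, V z -> {for z, continuous g}) ->
    (forall z, V z -> 1 <= g z) -> (path_dist V (conformal g) x y < +oo)%E ->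
    fine (path_dist V (conformal g) x y) = 0 -> x = y.
  move=> gc g1 h d0; have := path_dist_ge gc g1 x y; rewrite (fin _ _ _ _ gc g1 h) d0 lee_fin => h0.
  apply/eqP; rewrite -subr_eq0; apply/eqP/enorm_eq0.
  by apply/eqP; rewrite eq_le h0 enorm_ge0.
have Uoo x y : U x -> U y -> (path_dist U (conformal f) x y < +oo)%E.
  move=> Ux Uy; apply: (le_lt_trans (UleB x y Ux Uy)).
  by rewrite lte_add_pinfty ?ltry// Boo//; exact: UB.
have FU x y Ux Uy := fin _ _ _ _ fc f1 (Uoo x y Ux Uy).
have FB x y Bx By := fin _ _ _ _ Fc F1 (Boo x y Bx By).
rewrite (@eq_GH_dist _ _ _ U B _ (fun x y => (fine (path_dist U (conformal f) x y))%:E)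
  _ (fun x y => (fine (path_dist B (conformal F) x y))%:E))//.
apply: glued_GH_dist_le => //.
- by move=> x Ux; rewrite (refl _ _ _ fc f1 Ux).
- by move=> x y Ux Uy; apply: pos => //; exact: Uoo.
- by move=> x y Ux Uy; rewrite (path_dist_sym fc f1).
- move=> y x z Ux Uy Uz; rewrite -lee_fin EFinD -!FU//.
  exact: (path_dist_triangle fc f1).
- by move=> x Bx; rewrite (refl _ _ _ Fc F1 Bx).
- by move=> x y Bx By; apply: pos => //; exact: Boo.
- by move=> x y Bx By; rewrite (path_dist_sym Fc F1).
- move=> y x z Bx By Bz; rewrite -lee_fin EFinD -!FB//.
  exact: (path_dist_triangle Fc F1).
- by move=> x y Ux Uy; rewrite -lee_fin EFinD -FU// -FB; [exact: UleB|exact: UB|exact: UB].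
- by move=> x y Ux Uy; rewrite -lee_fin EFinD -FU// -FB; [exact: BleU|exact: UB|exact: UB].
- move=> y By; have [x Ux xy] := dense y By; exists x => //.
  by rewrite -lee_fin -FB//; exact: UB.
Qed.

Section PerforatedGH.
Variables (R : realType) (I : finType) (S : pred I) (p : I -> E3 R) (h r rho : R).
Hypothesis r_gt0 : 0 < r.
Hypothesis rh : 64 * r <= h.
Hypothesis rho_gt0 : 0 < rho.
Hypothesis p_dist : forall i j, i != j -> h <= enorm (p i - p j).
Hypothesis p_in : forall i, enorm (p i) + h <= rho.
Local Notation U := (perforated S p r rho).
Local Notation B := (eball (0 : E3 R) rho).
Variables (f F : E3 R -> R) (eta M : R).
Hypothesis fc : forall z, U z -> {for z, continuous f}.
Hypothesis f1 : forall z, U z -> 1 <= f z.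
Hypothesis Fc : forall z, B z -> {for z, continuous F}.
Hypothesis F1 : forall z, B z -> 1 <= F z.
Hypothesis eta_gt0 : 0 < eta.
Hypothesis eta_le1 : eta <= 1.
Hypothesis M_ge0 : 0 <= M.
Hypothesis FM : forall z, B z -> F z <= M.
Hypothesis fF : forall z, U z -> `|f z - F z| <= eta.
Hypothesis F_osc : forall z z', B z -> B z' -> enorm (z - z') <= 2 * h -> `|F z - F z'| <= eta.
Let Delta := M * (2 * rho).
Hypothesis reroute_small : ((Delta + 1) / (h / 16) + 1) * reroute_cost r M <= eta.
Hypothesis gap_small : M * (2 * r) <= eta.
Local Notation dU := (path_dist U (conformal f)).
Local Notation dB := (path_dist B (conformal F)).

(** With [Delta] bounding the diameter of the ball, rerouting loses at most eta * (3 * Delta + 5).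
    Hence [dU] is at most 4 * Delta + 5, and replacing [f] by [F] loses [eta] times that. *)
Definition perforated_GH_const := 4 * M * (2 * rho) + 5.

Let Delta_ge0 : 0 <= Delta.
Proof. by rewrite /Delta !mulr_ge0// ltW. Qed.

Let cost_ge0 : 0 <= reroute_cost r M.
Proof. by rewrite /reroute_cost !mulr_ge0 ?addr_ge0// ltW. Qed.

Let ball_segment x y : B x -> B y -> (dB x y <= (M * enorm (x - y))%:E)%E.
Proof.
move=> xB yB; apply: path_dist_segment => // t t01.
by have tB := eball_convex t01 xB yB; split => //; exact: FM.
Qed.

Let dB_le x y : B x -> B y -> (dB x y <= Delta%:E)%E.
Proof.
move=> xB yB; apply: (le_trans (ball_segment xB yB)); rewrite lee_fin ler_wpM2l//.
rewrite (le_trans (enormD _ _))// enormN mulr2n mulrDl mul1r.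
by move: xB yB; rewrite /eball/= !subr0 => /ltW ? /ltW ?; exact: lerD.
Qed.

Let dU_le x y : U x -> U y -> (dU x y <= dB x y + (eta * (2 + 3 * (Delta + 1)))%:E)%E.
Proof.
move=> Ux Uy; have := dB_le (perforated_sub Ux) (perforated_sub Uy) => dle.
have dge : ((0 : R)%:E <= dB x y)%E.
  by apply: le_trans (path_dist_ge Fc F1 x y); rewrite lee_fin enorm_ge0.
have dfin : dB x y \is a fin_num by rewrite ge0_fin_numE// (le_lt_trans dle)// ltry.
have [t dE] : exists t, dB x y = t%:E by exists (fine (dB x y)); rewrite fineK.
(* Rerouting starts from a strict upper bound, so [eta] is added to the distance; it is one of the
   two extra [eta] in the statement, the other being the bound in [reroute_small]. *)
have lt_lambda : (dB x y < (t + eta)%:E)%E by rewrite dE lte_fin ltrDl.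
have fF' z : U z -> f z <= F z + eta.
  by move=> /fF; rewrite ler_norml => /andP[_]; lra.
have := path_dist_reroute r_gt0 rh p_dist p_in fc f1 Fc F1 (ltW eta_gt0) eta_le1 FM fF' F_osc
  Ux Uy lt_lambda.
move: dle dge; rewrite dE !lee_fin => tD t0 /le_trans; apply.
rewrite -EFinD lee_fin.
have h0 : 0 < h / 16 by rewrite divr_gt0//; have := r_gt0; have := rh; lra.
have tE : t + eta <= Delta + 1 by have := eta_le1; lra.
have : ((t + eta) / (h / 16) + 1) * reroute_cost r M <= eta.
  apply: le_trans reroute_small; apply: ler_wpM2r => //.
  by rewrite lerD2r ler_pM2r// invr_gt0.
have : eta * (t + eta) <= eta * (Delta + 1) by rewrite ler_wpM2l// ltW.
lra.
Qed.

Let dB_le_dU x y : U x -> U y -> (dB x y <= dU x y + (eta * perforated_GH_const)%:E)%E.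
Proof.
move=> Ux Uy.
(* The additive error becomes multiplicative because [f] is at least 1. *)
have Ff z : U z -> F z <= (1 + eta) * f z.
  move=> Uz; have := fF Uz; rewrite ler_norml => /andP[h1 _].
  have : eta <= eta * f z by rewrite ler_peMr ?(ltW eta_gt0)// f1.
  lra.
have c0 : 0 < 1 + eta by rewrite addr_gt0.
apply: (le_trans (path_dist_mono x y (@perforated_sub _ _ _ _ _ _) fc f1 Fc F1 c0 Ff)).
have dUle : (dU x y <= (Delta + eta * (2 + 3 * (Delta + 1)))%:E)%E.
  by apply: (le_trans (dU_le Ux Uy)); rewrite EFinD leeD2r//; exact: dB_le (perforated_sub Ux) (perforated_sub Uy).
have dUge : ((0 : R)%:E <= dU x y)%E.
  by apply: le_trans (path_dist_ge fc f1 x y); rewrite lee_fin enorm_ge0.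
have dUfin : dU x y \is a fin_num by rewrite ge0_fin_numE// (le_lt_trans dUle)// ltry.
move: dUle dUge; rewrite -(fineK dUfin) -EFinM -EFinD !lee_fin; move: (fine _) => l lle lge.
rewrite mulrDl mul1r lerD2l ler_wpM2l ?(ltW eta_gt0)//.
have : eta * (2 + 3 * (Delta + 1)) <= 2 + 3 * (Delta + 1).
  by rewrite ler_piMl//; have := Delta_ge0; lra.
by move: lle; rewrite /perforated_GH_const /Delta; lra.
Qed.

Lemma perforated_GH_dist_le :
  (GH_dist U dU B dB <= (3 * (eta * perforated_GH_const))%:E)%E.
Proof.
have D0 := Delta_ge0; have CE : perforated_GH_const = 4 * Delta + 5.
  by rewrite /perforated_GH_const /Delta !mulrA.
have C1 : 1 <= perforated_GH_const by lra.
have eta_le : eta <= eta * perforated_GH_const by rewrite ler_peMr// ltW.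
apply: (GH_path_dist_le _ _ _ fc f1 Fc F1).
- by rewrite mulr_gt0// (lt_le_trans ltr01).
- exact: perforated_sub.
- have [|z [Uz _ _]] := @perforated_proj _ _ S p h r rho r_gt0 rh p_dist p_in 0; last by exists z.
  by rewrite /eball/= subr0 enorm0.
- by move=> x y xB yB; apply: (le_lt_trans (dB_le xB yB)); exact: ltry.
- move=> x y Ux Uy; apply: (le_trans (dU_le Ux Uy)).
  by rewrite leeD2l// lee_fin ler_wpM2l ?(ltW eta_gt0)// CE; lra.
- exact: dB_le_dU.
- move=> y yB; have [z [Uz yz _]] := perforated_proj S r_gt0 rh p_dist p_in yB.
  exists z => //; apply: (le_trans (ball_segment (perforated_sub Uz) yB)).
  rewrite lee_fin enorm_distC; apply: le_trans eta_le; apply: le_trans gap_small.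
  by rewrite ler_wpM2l.
Qed.

End PerforatedGH.

Lemma cvge_to0 (R : realType) (u : nat -> \bar R) : (forall n, 0 <= u n)%E ->
  (forall e : R, 0 < e -> \forall n \near \oo, (u n <= e%:E)%E) ->
  u @ \oo --> (0 : \bar R)%E.
Proof.
move=> u0 ue.
have fin n (e : R) : (u n <= e%:E)%E -> u n = (fine (u n))%:E.
  by move=> h; rewrite fineK// ge0_fin_numE// (le_lt_trans h)// ltry.
apply/fine_cvgP; split.
  by apply: filterS (ue 1 ltr01) => n /fin ->.
apply/cvgrPdist_le => e e0; apply: filterS (ue e e0) => n h /=.
by rewrite sub0r normrN ger0_norm ?fine_ge0// -lee_fin -(fin _ _ h).
Qed.

Lemma ler_distM (R : realType) (u v u' v' p q a b : R) :
  `|u| <= p -> `|v'| <= q -> `|u - u'| <= a -> `|v - v'| <= b ->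
  `|u * v - u' * v'| <= p * b + q * a.
Proof.
move=> up vq ua vb.
have -> : u * v - u' * v' = u * (v - v') + v' * (u - u') by ring.
by rewrite (le_trans (ler_normD _ _))// !normrM lerD// ler_pM.
Qed.

Lemma lipschitz_continuous (R : realType) (f : E3 R -> R) (L : R) :
  (forall x y, `|f x - f y| <= L * enorm (x - y)) -> continuous f.
Proof.
move=> fL x; apply/cvgrPdist_lt => e e0.
have cn : (fun y : E3 R => (`|L| + 1) * enorm (x - y)) @ x --> (`|L| + 1) * 0.
  apply: cvgMr; rewrite -(@enorm0 R) -[X in enorm X](subrr x).
  apply: (@cvg_comp _ _ _ (fun y : E3 R => x - y) (@enorm R)); last exact: enorm_continuous.
  by apply: cvgB; [exact: cvg_cst|exact: cvg_id].
rewrite mulr0 in cn; move/cvgrPdist_lt/(_ _ e0) : cn; apply: filterS => y.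
rewrite sub0r normrN => h; apply: le_lt_trans h; apply: (le_trans (fL x y)).
rewrite (le_trans _ (ler_norm _))// ler_wpM2r ?enorm_ge0//.
by rewrite (le_trans (ler_norm L))// lerDl.
Qed.

Lemma sum_factor_continuous (R : realType) (D : R) (n : nat) (m : box n -> R) (z : E3 R) :
  (forall i, m i != 0 -> 0 < enorm (z - box_center D i)) ->
  {for z, continuous (sum_factor D m)}.
Proof.
move=> zm; rewrite /continuous_at /sum_factor; apply: cvgD; first exact: cvg_cst.
apply: (@cvg_big _ _ +%R 0 xpredT (@add_continuous R^o)) => i _.
have [->|mi] := eqVneq (m i) 0.
  rewrite mul0r; under eq_fun do rewrite mul0r; exact: cvg_cst.
apply: cvgMr; apply: cvgV; first by rewrite gt_eqF// zm.
apply: (@cvg_comp _ _ _ (fun y : E3 R => y - box_center D i) (@enorm R)); last exact: enorm_continuous.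
by apply: cvgB; [exact: cvg_id|exact: cvg_cst].
Qed.

Lemma sum_factor_ge1 (R : realType) (D : R) (n : nat) (m : box n -> R) (z : E3 R) :
  (forall i, 0 <= m i) -> 1 <= sum_factor D m z.
Proof.
by move=> m0; rewrite /sum_factor lerDl sumr_ge0// => i _; rewrite divr_ge0// enorm_ge0.
Qed.

Theorem theorem1p4 (R : realType) (D : R) (A B : E3 R -> R)
    (alpha beta : forall n : nat, box n -> R) (rho : R)
    (D_gt0 : 0 < D)
    (A_smooth : smooth (A : E3 R -> R^o)) (B_smooth : smooth (B : E3 R -> R^o))
    (A_ge0 : forall x, 0 <= A x) (B_ge0 : forall x, 0 <= B x)
    (A_supp : supported_in (cube D) A) (B_supp : supported_in (cube D) B)
    (alphaP : riemann_parameters D A alpha)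
    (betaP : riemann_parameters D B beta)
    (rho_gt : Num.sqrt 3 * D < rho) :
  let U n := perforated_ball D alpha beta n rho in
  let g_ n := conformal (fun x =>
    sum_factor D (alpha n) x * sum_factor D (beta n) x) in
  let g := conformal (fun x => limit_factor A x * limit_factor B x) in
  (fun n : nat => GH_dist (U n) (path_dist (U n) (g_ n))
                          (eball 0 rho) (path_dist (eball 0 rho) g))
    @ \oo --> (0 : \bar R)%E.
Proof.
move=> U g_ g; have [alpha0 _] := alphaP; have [beta0 _] := betaP.
have contS (G : E3 R -> R) : smooth (G : E3 R -> R^o) -> continuous G.
  by move=> GS x; exact: differentiable_continuous (GS [::] x).
have cA := contS _ A_smooth; have cB := contS _ B_smooth.
have [MA MA0 AM] := bounded_density cA A_supp.
have [MB MB0 BM] := bounded_density cB B_supp.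
have rho0 : 0 < rho by apply: le_lt_trans rho_gt; rewrite mulr_ge0// ltW.
have K0 := kernel_bound_gt0 D_gt0.
pose chi := limit_factor A; pose psi := limit_factor B.
have chi_ge1 x : 1 <= chi x by exact: limit_factor_ge1 A_supp A_ge0 x.
have psi_ge1 x : 1 <= psi x by exact: limit_factor_ge1 B_supp B_ge0 x.
have ballE (x : E3 R) : eball 0 rho x -> enorm x <= rho.
  by rewrite /eball/= subr0 => /ltW.
have [XA XA1 chi_le] : exists2 X, 1 <= X & forall x, eball 0 rho x -> chi x <= X.
  exists (1 + MA * (rho + 2 * D) * kernel_bound D) => [|x /ballE]; last exact: limit_factor_le.
  by rewrite lerDl !mulr_ge0 ?addr_ge0 ?mulr_ge0 ?ltW.
have [XB XB1 psi_le] : exists2 X, 1 <= X & forall x, eball 0 rho x -> psi x <= X.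
  exists (1 + MB * (rho + 2 * D) * kernel_bound D) => [|x /ballE]; last exact: limit_factor_le.
  by rewrite lerDl !mulr_ge0 ?addr_ge0 ?mulr_ge0 ?ltW.
have [LA LA0 chi_lip] : exists2 L, 0 <= L & forall x y, `|chi x - chi y| <= L * enorm (x - y).
  exists (MA * kernel_bound D) => [|x y]; last exact: limit_factor_lipschitz.
  by rewrite mulr_ge0 ?ltW.
have [LB LB0 psi_lip] : exists2 L, 0 <= L & forall x y, `|psi x - psi y| <= L * enorm (x - y).
  exists (MB * kernel_bound D) => [|x y]; last exact: limit_factor_lipschitz.
  by rewrite mulr_ge0 ?ltW.
pose F x := chi x * psi x.
have F1 x : 1 <= F x by rewrite /F -[1]mulr1 ler_pM.
have chi_ge0 x : 0 <= chi x by apply: le_trans (chi_ge1 x).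
have psi_ge0 x : 0 <= psi x by apply: le_trans (psi_ge1 x).
have [MF MF1 FM] : exists2 M, 1 <= M & forall x, eball 0 rho x -> F x <= M.
  exists (XA * XB) => [|x xB]; first by rewrite -[1]mulr1 ler_pM.
  by rewrite /F ler_pM// ?chi_le ?psi_le.
have Fc x : {for x, continuous F}.
  apply: cvgM; first exact: (lipschitz_continuous chi_lip).
  exact: (lipschitz_continuous psi_lip).
have [Lam Lam0 FLip] : exists2 L, 0 <= L & forall x y, eball 0 rho x -> eball 0 rho y ->
    `|F x - F y| <= L * enorm (x - y).
  exists (XA * LB + XB * LA) => [|x y xB yB].
    by rewrite addr_ge0// mulr_ge0// (le_trans ler01).
  rewrite mulrDl -!mulrA; apply: ler_distM => //.
  - by rewrite ger0_norm// chi_le.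
  - by rewrite ger0_norm// psi_le.
pose K := perforated_GH_const rho MF.
have MF0 : 0 <= MF by exact: le_trans ler01 MF1.
have K_gt0 : 0 < K.
  by rewrite /K /perforated_GH_const ltr_wpDl// !mulr_ge0// ltW.
suff main (eta : R) : 0 < eta -> eta <= 1 -> \forall n \near \oo,
    (GH_dist (U n) (path_dist (U n) (g_ n)) (eball (0%R : E3 R) rho)
      (path_dist (eball (0%R : E3 R) rho) g) <= (3 * (eta * K))%:E)%E.
  apply: cvge_to0 => [n|eps eps0]; first exact: GH_dist_ge0.
  have K3 : 0 < 3 * K by rewrite mulr_gt0.
  pose eta := Num.min 1 (eps / (3 * K)).
  have eta0 : 0 < eta by rewrite /eta lt_min ltr01 divr_gt0.
  have eta1 : eta <= 1 by rewrite /eta ge_min lexx.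
  apply: filterS (main eta eta0 eta1) => n /le_trans; apply.
  have : eta <= eps / (3 * K) by rewrite /eta ge_min lexx orbT.
  by rewrite lee_fin ler_pdivlMr// mulrCA.
move=> eta0 eta1.
(* The product of the two factors then errs by at most (XA + 1) * e + XB * e = eta, where [XA + 1]
   bounds the discrete factor and [XB] the limit one. *)
pose e := eta / (XA + XB + 1).
have X0 : 0 < XA + XB + 1.
  by rewrite ltr_wpDl// addr_ge0// (le_trans ler01).
have e0 : 0 < e by rewrite divr_gt0.
have e1 : e <= 1.
  rewrite /e ler_pdivrMr// mul1r (le_trans eta1)// lerDr addr_ge0// (le_trans ler01)//.
have nearA := sum_factor_cvg D_gt0 cA A_ge0 A_supp alphaP rho0 e0.
have nearB := sum_factor_cvg D_gt0 cB B_ge0 B_supp betaP rho0 e0.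
pose Delta := MF * (2 * rho).
(* With h = D / n and r = h / n, the total overhead of rerouting is at most [W / n]. *)
pose W := ((Delta + 1) * 16 + D) * (6 * (MF + 2)).
near=> n.
have n0 : (0 < n)%N by near: n; exact: nbhs_infty_gt.
have N0 : (0 : R) < n%:R by rewrite ltr0n.
have n64 : 64 <= n%:R :> R by near: n; exact: nbhs_infty_ger.
have n_rho : D / (rho - Num.sqrt 3 * D) <= n%:R by near: n; exact: nbhs_infty_ger.
have n_osc : Lam * (2 * D) / eta <= n%:R by near: n; exact: nbhs_infty_ger.
have n_W : W / eta <= n%:R by near: n; exact: nbhs_infty_ger.
have n_gap : MF * (2 * D) / eta <= n%:R by near: n; exact: nbhs_infty_ger.
have closeA : forall x : E3 R, enorm x <= rho ->
    (forall i, alpha n i != 0 -> D / n%:R ^+ 2 <= enorm (x - box_center D i)) ->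
    `|sum_factor D (alpha n) x - chi x| <= e by near: n.
have closeB : forall x : E3 R, enorm x <= rho ->
    (forall i, beta n i != 0 -> D / n%:R ^+ 2 <= enorm (x - box_center D i)) ->
    `|sum_factor D (beta n) x - psi x| <= e by near: n.
pose r := D / n%:R ^+ 2; pose h := D / n%:R.
have r0 : 0 < r by rewrite divr_gt0// exprn_gt0.
have h0 : 0 < h by rewrite divr_gt0.
have rE : r = h / n%:R by rewrite /r /h; field; rewrite gt_eqF.
have rh : 64 * r <= h by rewrite rE mulrA ler_pdivrMr// mulrC ler_wpM2l// ltW.
have n1 : 1 <= n%:R :> R by rewrite ler1n.
have r_le_h : r <= h by rewrite rE ler_pdivrMr// ler_peMr// ltW.
(* As sqrt 3 * D < rho, the centers stay a fixed distance inside the ball, so for large [n] the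
   balls of radius [h] around them fit as well. *)
have p_in (i : box n) : enorm (box_center D i) + h <= rho.
  rewrite -lerBrDl; apply: (@le_trans _ _ (rho - Num.sqrt 3 * D)).
    by rewrite /h ler_pdivrMr// mulrC -ler_pdivrMr// subr_gt0.
  by rewrite lerD2l lerN2; exact: enorm_box_center.
pose S (i : box n) := alpha n i + beta n i != 0.
pose f x := sum_factor D (alpha n) x * sum_factor D (beta n) x.
(* The parameters are nonnegative and cannot cancel: a box that carries mass in either factor has
   its hole removed. *)
have SA i : alpha n i != 0 -> S i.
  by move=> ai; rewrite /S paddr_eq0// negb_and ai.
have SB i : beta n i != 0 -> S i.
  by move=> bi; rewrite /S paddr_eq0// negb_and bi orbT.
(* By computation, [U n] is the [perforated] set of the boxes that are kept. *)
have off z i : U n z -> S i -> r <= enorm (z - box_center D i).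
  by move=> /(@perforatedP _ _ S (@box_center R D n) r rho z)[_]; apply.
have fc z : U n z -> {for z, continuous f}.
  move=> Uz; apply: cvgM; apply: sum_factor_continuous => i.
    by move=> /SA/(off _ _ Uz); exact: lt_le_trans.
  by move=> /SB/(off _ _ Uz); exact: lt_le_trans.
have f1 z : U n z -> 1 <= f z.
  by move=> _; rewrite /f -[1]mulr1 ler_pM// sum_factor_ge1.
have fF z : U n z -> `|f z - F z| <= eta.
  move=> Uz; have zB : eball 0 rho z by case: Uz.
  have hA := closeA z (ballE _ zB) (fun i ai => off z i Uz (SA i ai)).
  have hB := closeB z (ballE _ zB) (fun i bi => off z i Uz (SB i bi)).
  have nA : `|sum_factor D (alpha n) z| <= XA + 1.
    rewrite -[sum_factor _ _ _](subrK (chi z)) addrC (le_trans (ler_normD _ _))// lerD//.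
      by rewrite ger0_norm// chi_le.
    exact: le_trans hA e1.
  have nB : `|psi z| <= XB by rewrite ger0_norm// psi_le.
  have := ler_distM nA nB hA hB; move/le_trans; apply.
  rewrite -mulrDl [X in X * e](_ : _ = XA + XB + 1); last by rewrite addrAC.
  by rewrite /e mulrCA divff ?mulr1// gt_eqF.
have F_osc z z' : eball 0 rho z -> eball 0 rho z' -> enorm (z - z') <= 2 * h ->
    `|F z - F z'| <= eta.
  move=> zB zB' zz'; apply: (le_trans (FLip _ _ zB zB')).
  apply: (@le_trans _ _ (Lam * (2 * h))); first by rewrite ler_wpM2l.
  by rewrite /h !mulrA ler_pdivrMr// -mulrA (mulrC eta) -ler_pdivrMr.
apply: (@perforated_GH_dist_le _ _ S (@box_center R D n) h r rho r0 rh rho0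
  (box_center_dist D_gt0 n0) p_in f F eta MF fc f1 (fun z _ => Fc z) (fun z _ => F1 z)
  eta0 eta1 MF0 FM fF F_osc).
- rewrite -/Delta /reroute_cost.
  have -> : ((Delta + 1) / (h / 16) + 1) * (6 * r * (MF + 2)) =
      ((Delta + 1) * 16 + h) * (6 * (MF + 2)) / n%:R.
    by rewrite rE; field; rewrite !gt_eqF.
  rewrite ler_pdivrMr// (mulrC eta) -ler_pdivrMr//; apply: le_trans n_W.
  rewrite ler_wpM2r ?invr_ge0 ?(ltW eta0)// /W ler_wpM2r ?mulr_ge0 ?addr_ge0//.
  by rewrite lerD2l /h ler_pdivrMr// ler_peMr// ltW.
- apply: (@le_trans _ _ (MF * (2 * h))); first by rewrite ler_wpM2l// ler_wpM2l.
  by rewrite /h !mulrA ler_pdivrMr// -mulrA (mulrC eta) -ler_pdivrMr.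
Unshelve. all: by end_near. Qed.
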